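(* Let $(M,I,J,K)$ be a hypercomplex manifold with twistor space $(Z=M\times S^2,\mathcal I)$, let $g$ be a hyperhermitian metric on $M$, and let $P_I$ be the bivector field on $M$ dual to the fundamental form of $(g,I)$. Let $\mathcal P$ be the bivector field on $Z$ whose value at $(x,\mathbf a)\in Z$ is $\mathcal P_{(x,\mathbf a)}=\big((s_{\mathbf a})_*P_I\big)^{(2,0)}$, the $(2,0)$-component with respect to $\mathcal I$ of $(s_{\mathbf a})_*(P_I)$ at $(x,\mathbf a)$. Then $g$ is HKT if and only if $\mathcal P$ is a complex Poisson structure on $(Z,\mathcal I)$.
   Context: A hypercomplex structure on $M$ is a triple $I,J,K$ of (integrable) complex structures with $IJ=-JI=K$. A Riemannian metric $g$ is hyperhermitian if it is Hermitian with respect to $I,J,K$; put $\omega_A(X,Y)=g(AX,Y)$ for $A=I,J,K$. The metric $g$ is called HKT (hyperk\''ahler with torsion) if $d^c_I\omega_I=d^c_J\omega_J=d^c_K\omega_K$, where $d^c_A=i(\overline\partial_A-\partial_A)$ (the overall real normalization is immaterial). The bivector $P_I=\omega_I^{-1}$ dual to the fundamental form $\omega_I$ is defined by $\omega_I^{-1}(\alpha,\beta)=\beta(\omega_I^{-1}(\alpha))$, where $\omega_I^{-1}:T^*M\to TM$ is the inverse of $X\mapsto i_X\omega_I$. Twistor space: for $\mathbf a=(a,b,c)\in S^2\subset\mathbb R^3$ put $I_{\mathbf a}=aI+bJ+cK$, which is a complex structure on $M$. On $Z=M\times S^2$ the complex structure $\mathcal I$ is defined by $\mathcal I_{(x,\mathbf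 a)}=(I_{\mathbf a},I_{S^2})$ on $T_xM\oplus T_{\mathbf a}S^2$, where $I_{S^2}$ is the canonical complex structure of $S^2\cong\mathbb{CP}^1$, $I_{S^2}(v)=\mathbf a\times v$ for $v\in T_{\mathbf a}S^2=\mathbf a^\perp$; $\mathcal I$ is integrable. For $\mathbf a\in S^2$, $s_{\mathbf a}:M\to Z$ is the map $s_{\mathbf a}(x)=(x,\mathbf a)$. A complex Poisson structure on a complex manifold is a smooth bivector field $P$ of type $(2,0)$ (not required to be holomorphic) with $[P,P]=0$, where $[\cdot,\cdot]$ is the Schouten bracket extended complex-linearly to complex-valued multivector fields. *)

(* Defs.v *)
From mathcomp Require Export all_boot all_order all_algebra.
From mathcomp Require Export all_classical all_reals all_analysis.
From mathcomp Require Export ring complex.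

Set Implicit Arguments.
Unset Strict Implicit.
Unset Printing Implicit Defensive.

Import Order.TTheory GRing.Theory Num.Theory.
Export numFieldNormedType.Exports.

Local Open Scope classical_set_scope.
Local Open Scope complex_scope.
Local Open Scope ring_scope.

(* Row-vector convention throughout, as in the library's ['J f x]: a tangent   *)
(* vector is a row, an endomorphism A acts by v |-> v *m A, so that the matrix *)
(* of the composite "first B, then A" is B *m A.  A bilinear form G is         *)
(* (v, w) |-> v *m G *m w^T, a bivector P is (alpha, beta) |-> alpha P beta^T  *)
(* on covectors written as rows.                                               *)

Section Calculus.
Context {R : realType} {n : nat}.

Definition partial (i : 'I_n) (f : 'rV[R]_n -> R) : 'rV[R]_n -> R :=
  fun u => 'D_(delta_mx 0 i) f u.

Definition iter_partial (s : seq 'I_n) (f : 'rV[R]_n -> R) : 'rV[R]_n -> R :=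
  foldr partial f s.

(* For open U this is C^oo: differentiability of all iterated partial          *)
(* derivatives entails their continuity.                                       *)
Definition smooth_on (U : set 'rV[R]_n) (f : 'rV[R]_n -> R) : Prop :=
  forall (s : seq 'I_n) u, U u -> differentiable (iter_partial s f) u.

Definition smooth_mx_on (U : set 'rV[R]_n) p q (F : 'rV[R]_n -> 'M[R]_(p, q)) :=
  forall i j, smooth_on U (fun u => F u i j).

Definition smooth_cmx_on (U : set 'rV[R]_n) p q
    (F : 'rV[R]_n -> 'M[R[i]]_(p, q)) :=
  smooth_mx_on U (fun u => map_mx (@complex.Re R) (F u)) /\
  smooth_mx_on U (fun u => map_mx (@complex.Im R) (F u)).

Definition cpartial (i : 'I_n) (f : 'rV[R]_n -> R[i]) : 'rV[R]_n -> R[i] :=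
  fun u => partial i (fun v => complex.Re (f v)) u
           +i* partial i (fun v => complex.Im (f v)) u.

Definition lie_bracket (X Y : 'rV[R]_n -> 'rV[R]_n) : 'rV[R]_n -> 'rV[R]_n :=
  fun u => 'D_(X u) Y u - 'D_(Y u) X u.

Definition nijenhuis (A : 'rV[R]_n -> 'M[R]_n) (X Y : 'rV[R]_n -> 'rV[R]_n) :=
  let AX u := X u *m A u in
  let AY u := Y u *m A u in
  fun u => lie_bracket AX AY u - lie_bracket AX Y u *m A u
           - lie_bracket X AY u *m A u - lie_bracket X Y u.

Definition mxC p q (A : 'M[R]_(p, q)) : 'M[R[i]]_(p, q) :=
  map_mx (fun x => x%:C) A.

(* Projection of the complexified tangent space onto T^{1,0} (b = true) or     *)
(* T^{0,1} (b = false).                                                        *)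
Definition type_proj (A : 'M[R]_n) (b : bool) : 'M[R[i]]_n :=
  2%:R^-1 *: (if b then 1%:M - 'i *: mxC A else 1%:M + 'i *: mxC A).

(* A 2-form is the matrix of its values on coordinate vector fields; this is   *)
(* its component of type (p, 2 - p).                                           *)
Definition form2_part (A : 'M[R]_n) (p : nat) (al : 'M[R[i]]_n) : 'M[R[i]]_n :=
  \sum_(e : bool * bool | (e.1 + e.2)%N == p)
    type_proj A e.1 *m al *m (type_proj A e.2)^T.

Definition tensor3 := 'I_n -> 'I_n -> 'I_n -> R[i].

Definition form3_part (A : 'M[R]_n) (p : nat) (tau : tensor3) : tensor3 :=
  fun i j k =>
  \sum_(e : bool * bool * bool | (e.1.1 + e.1.2 + e.2)%N == p)
    \sum_(a < n) \sum_(b < n) \sum_(c < n)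
      type_proj A e.1.1 i a * type_proj A e.1.2 j b * type_proj A e.2 k c
      * tau a b c.

Definition ext_d2 (al : 'rV[R]_n -> 'M[R[i]]_n) (u : 'rV[R]_n) : tensor3 :=
  fun i j k => cpartial i (fun v => al v j k) u
             - cpartial j (fun v => al v i k) u
             + cpartial k (fun v => al v i j) u.

Definition del (A : 'rV[R]_n -> 'M[R]_n) (al : 'rV[R]_n -> 'M[R[i]]_n)
    (u : 'rV[R]_n) : tensor3 :=
  fun i j k => \sum_(p < 3)
    form3_part (A u) p.+1 (ext_d2 (fun v => form2_part (A v) p (al v)) u) i j k.

Definition delbar (A : 'rV[R]_n -> 'M[R]_n) (al : 'rV[R]_n -> 'M[R[i]]_n)
    (u : 'rV[R]_n) : tensor3 :=
  fun i j k => \sum_(p < 3)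
    form3_part (A u) p (ext_d2 (fun v => form2_part (A v) p (al v)) u) i j k.

Definition dc (A : 'rV[R]_n -> 'M[R]_n) (al : 'rV[R]_n -> 'M[R[i]]_n)
    (u : 'rV[R]_n) : tensor3 :=
  fun i j k => 'i * (delbar A al u i j k - del A al u i j k).

Definition bivector20 (A : 'M[R]_n) (P : 'M[R[i]]_n) : 'M[R[i]]_n :=
  (type_proj A true)^T *m P *m type_proj A true.

(* Coordinate expression of the Schouten bracket of bivector fields, for the   *)
(* sign convention [X1 ^ X2, Y1 ^ Y2] = sum (-1)^(i+j) [Xi, Yj] ^ ...          *)
Definition schouten (P Q : 'rV[R]_n -> 'M[R[i]]_n) (u : 'rV[R]_n) : tensor3 :=
  let t i j k := \sum_(l < n) (P u i l * cpartial l (fun v => Q v j k) u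
                             + Q u i l * cpartial l (fun v => P v j k) u) in
  fun i j k => t i j k + t j k i + t k i j.

End Calculus.

(* [param i] is the inverse of the chart [coord i] on its image; the values of *)
(* [coord i] outside [dom i] and of [param i] outside the image are junk.      *)
Record atlas (R : realType) (n : nat) := Atlas {
  point :> Type;
  index : Type;
  dom : index -> set point;
  coord : index -> point -> 'rV[R]_n;
  param : index -> 'rV[R]_n -> point }.

Arguments dom {R n} a _ _.
Arguments coord {R n} a _ _.
Arguments param {R n} a _ _.

Section Manifold.
Context {R : realType} {n : nat} (M : atlas R n).

Definition transition (i j : index M) : 'rV[R]_n -> 'rV[R]_n :=
  coord M j \o param M i.

Definition chart_image (i : index M) : set 'rV[R]_n := coord M i @` dom M i.

(* Open sets of the topology for which all charts are homeomorphisms. *)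
Definition atlas_open (A : set M) : Prop :=
  forall i, open (coord M i @` (dom M i `&` A)).

Definition smooth_manifold : Prop :=
  [/\ forall x : M, exists i, dom M i x,
      forall i x, dom M i x -> param M i (coord M i x) = x,
      forall i j, let U := coord M i @` (dom M i `&` dom M j) in
        open U /\ smooth_mx_on U (transition i j),
      forall x y : M, x <> y -> exists A B : set M,
        [/\ atlas_open A, atlas_open B, A x, B y & A `&` B = set0]
    & exists D : set (index M), countable D /\
        forall x : M, exists2 i, D i & dom M i x].

Definition components (K : Type) := index M -> M -> 'M[K]_n.

Definition in_chart (K : Type) (T : components K) (i : index M) :
  'rV[R]_n -> 'M[K]_n := fun u => T i (param M i u).

Definition endomorphism_field (A : components R) : Prop :=
  (forall i j x, dom M i x -> dom M j x ->
     let D := 'J (transition i j) (coord M i x) in A i x *m D = D *m A j x) /\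
  (forall i, smooth_mx_on (chart_image i) (in_chart A i)).

Definition bilinear_field (G : components R) : Prop :=
  (forall i j x, dom M i x -> dom M j x ->
     let D := 'J (transition i j) (coord M i x) in G i x = D *m G j x *m D^T) /\
  (forall i, smooth_mx_on (chart_image i) (in_chart G i)).

Definition bivector_field (P : components R[i]) : Prop :=
  [/\ forall i x, dom M i x -> (P i x)^T = - P i x,
      forall i j x, dom M i x -> dom M j x ->
        let D := mxC ('J (transition i j) (coord M i x)) in
        P j x = D^T *m P i x *m D
    & forall i, smooth_cmx_on (chart_image i) (in_chart P i)].

Definition complex_structure (A : components R) : Prop :=
  [/\ endomorphism_field A,
      forall i x, dom M i x -> A i x *m A i x = - 1%:M
    & forall i (X Y : 'rV[R]_n -> 'rV[R]_n),
        smooth_mx_on (chart_image i) X -> smooth_mx_on (chart_image i) Y ->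
        forall u, chart_image i u -> nijenhuis (in_chart A i) X Y u = 0].

(* IJ = K = - JI, where IJ is the composite "first J, then I". *)
Definition hypercomplex (I J K : components R) : Prop :=
  [/\ complex_structure I, complex_structure J, complex_structure K
    & forall i x, dom M i x ->
        J i x *m I i x = K i x /\ I i x *m J i x = - K i x].

Definition riemannian_metric (g : components R) : Prop :=
  [/\ bilinear_field g,
      forall i x, dom M i x -> (g i x)^T = g i x
    & forall i x (v : 'rV[R]_n), dom M i x -> v != 0 ->
        0 < (v *m g i x *m v^T) 0 0].

Definition hermitian (A g : components R) : Prop :=
  forall i x, dom M i x -> A i x *m g i x *m (A i x)^T = g i x.

Definition hyperhermitian (I J K g : components R) : Prop :=
  [/\ riemannian_metric g, hermitian I g, hermitian J g & hermitian K g].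

(* omega_A(X, Y) = g(AX, Y) *)
Definition fundamental_form (A g : components R) : components R :=
  fun i x => A i x *m g i x.

(* X |-> i_X omega is v |-> v *m omega, so this is the matrix of the bivector  *)
(* (alpha, beta) |-> beta(omega^-1(alpha)).                                    *)
Definition dual_bivector (om : components R) : components R :=
  fun i x => invmx (om i x).

Definition dc_fundamental (A g : components R) (i : index M) :
    'rV[R]_n -> tensor3 :=
  dc (in_chart A i) (fun u => mxC (in_chart (fundamental_form A g) i u)).

Definition HKT (I J K g : components R) : Prop :=
  forall i u, chart_image i u -> forall a b c,
    dc_fundamental I g i u a b c = dc_fundamental J g i u a b c /\
    dc_fundamental J g i u a b c = dc_fundamental K g i u a b c.

Definition complex_poisson (A : components R) (P : components R[i]) : Prop :=
  [/\ bivector_field P,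
      forall i x, dom M i x -> bivector20 (A i x) (P i x) = P i x
    & forall i u, chart_image i u -> forall a b c,
        schouten (in_chart P i) (in_chart P i) u a b c = 0].

End Manifold.

(* Push-forward along f of the bivector Q at x, from chart i to chart j. *)
Definition pushforward_bivector {R : realType} {m n : nat} {M : atlas R m}
    {N : atlas R n} (f : M -> N) (i : index M) (j : index N) (x : M)
    (Q : 'M[R]_m) : 'M[R]_n :=
  let D := 'J (coord N j \o f \o param M i) (coord M i x) in D^T *m Q *m D.

Definition product_atlas {R : realType} {m n : nat} (M : atlas R m)
    (N : atlas R n) : atlas R (m + n) :=
  @Atlas R (m + n) (M * N)%type (index M * index N)%type
    (fun i z => dom M i.1 z.1 /\ dom N i.2 z.2)
    (fun i z => row_mx (coord M i.1 z.1) (coord N i.2 z.2))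
    (fun i u => (param M i.1 (lsubmx u), param N i.2 (rsubmx u))).

Section Sphere.
Context (R : realType).

Definition sphere := {a : 'rV[R]_3 | \sum_k a 0 k ^+ 2 == 1}.

(* The chart b projects from the pole (0, 0, (-1)^b). *)
Definition stereo (b : bool) (a : sphere) : 'rV[R]_2 :=
  \row_k ([:: val a 0 0; val a 0 1]`_k / (1 - (-1) ^+ b * val a 0 2)).

Definition stereo_inv_vec (b : bool) (u : 'rV[R]_2) : 'rV[R]_3 :=
  let r := u 0 0 ^+ 2 + u 0 1 ^+ 2 in
  \row_k ([:: 2 * u 0 0; 2 * u 0 1; (-1) ^+ b * (r - 1)]`_k / (r + 1)).

Lemma stereo_inv_subproof b u :
  \sum_k stereo_inv_vec b u 0 k ^+ 2 == 1.
Proof.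
rewrite !big_ord_recl big_ord0 !mxE /=; set r := _ ^+ 2 + _ ^+ 2.
have r1 : r + 1 != 0 by rewrite gt_eqF// ltr_wpDl// addr_ge0// sqr_ge0.
apply/eqP; rewrite addr0 !exprMn -exprM mulnC exprM sqrrN expr1n expr1n mul1r.
by rewrite -!mulrDl addrA -mulrDr -/r exprVn; field.
Qed.

Definition stereo_inv (b : bool) (u : 'rV[R]_2) : sphere :=
  exist _ (stereo_inv_vec b u) (stereo_inv_subproof b u).

Definition sphere_atlas : atlas R 2 :=
  @Atlas R 2 sphere bool (fun b a => val a 0 2 != (-1) ^+ b) stereo stereo_inv.

Definition cross (a v : 'rV[R]_3) : 'rV[R]_3 :=
  \row_k [:: a 0 1 * v 0 2 - a 0 2 * v 0 1;
             a 0 2 * v 0 0 - a 0 0 * v 0 2;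
             a 0 0 * v 0 1 - a 0 1 * v 0 0]`_k.

(* Components of I_{S^2}(v) = a x v: the rows of D are the images in R^3 of    *)
(* the coordinate vector fields, and [pinvmx D] takes coordinates with respect *)
(* to these rows.                                                              *)
Definition sphere_complex_structure : components sphere_atlas R :=
  fun b a =>
  let D := 'J (stereo_inv_vec b) (stereo b a) in
  D *m lin1_mx (cross (val a)) *m pinvmx D.

End Sphere.

Section Twistor.
Context {R : realType} {n : nat} (M : atlas R n).

Definition twistor_space : atlas R (n + 2) := product_atlas M (sphere_atlas R).

Definition sphere_combination (I J K : components M R) (a : sphere R) :
    components M R :=
  fun i x => val a 0 0 *: I i x + val a 0 1 *: J i x + val a 0 2 *: K i x.

Definition twistor_structure (I J K : components M R) :
    components twistor_space R :=
  fun k z => block_mx (sphere_combination I J K z.2 k.1 z.1) 0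
                      0 (@sphere_complex_structure R k.2 z.2).

Definition sphere_section (a : sphere R) : M -> twistor_space := fun x => (x, a).

Definition twistor_bivector (I J K g : components M R) :
    components twistor_space R[i] :=
  fun k z =>
  bivector20 (twistor_structure I J K k z)
    (mxC (pushforward_bivector (sphere_section z.2) k.1 k z.1
            (dual_bivector (fundamental_form I g) k.1 z.1))).

End Twistor.

(* Main.v *)
(** The bivector is [P = Q_a] on the slice [M x {a}], with
    [Q_a = ((1 - a^2) P_I - (ab + ic) P_J - (ac - ib) P_K) / 2]; its coefficients
    form a null vector of C^3 and no derivative along the sphere enters [[P, P]].
    Hence P is Poisson iff all [[Q_a, Q_a]] vanish, i.e. iff the Schouten brackets
    [[P_s, P_t]], with s, t among I, J, K, form a scalar matrix.

    Inverting [omega] turns [[P_A, P_A]] into [2 d omega_A] with indices raised by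
    [P_A]; as [d omega_A] has no (3,0) part, [d^c_A omega_A] is minus [d omega_A]
    evaluated on A-rotated vectors, so [[P_A, P_A]] is [2 d^c_A omega_A] with indices
    raised by g.  Thus HKT says that the diagonal brackets agree.  The off-diagonal
    ones then vanish: [P_J - i P_K] is of type (2,0) for I, so its bracket with itself
    is of type (3,0), and a (3,0) trivector whose real part
    [[P_J, P_J] - [P_K, P_K]] is zero is zero.

    Everything but the chart bookkeeping is an identity between 1-jets at a point,
    proved over a field containing a square root of -1; using both roots replaces
    taking real and imaginary parts. *)
Require Import Defs.

Set Implicit Arguments.
Unset Strict Implicit.
Unset Printing Implicit Defensive.

Import Order.TTheory GRing.Theory Num.Theory.

Local Open Scope classical_set_scope.
Local Open Scope complex_scope.
Local Open Scope ring_scope.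

(** * Tensor algebra of 1-jets *)

(** Integrability enters at two places through one fact, [eigen_torsion]: the eigenvector fields of
    a complex structure for one eigenvalue are closed under bracket. On forms it removes the (3,0)
    part of [d omega]; on bivectors it makes the bracket of a (2,0) field a (3,0) field.

    The two directions are not mirror images. The bracket of [Q_a] is the value at a null vector of
    the quadratic form given by the matrix of brackets, so a scalar matrix kills all slices at once.
    In the other direction HKT asks only for equal diagonal entries, and four slices give them:
    those at the second and third unit vectors and at their antipodes. Antipodal points carry
    conjugate coefficients, so adding their two equations cancels the off-diagonal entry and leaves
    a difference of diagonal ones.

    First jets are enough because the Schouten bracket, the Nijenhuis tensor and [d^c] on forms of
    type (1,1) are first-order expressions. *)

Section Jets.
Context {C : numFieldType} {n : nat}.
Implicit Types (A T Q P w X Y Z : 'M[C]_n) (d dA dQ dw : 'I_n -> 'M[C]_n).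

(* A field and its first derivatives at a point are given as a matrix and a
   family [d], [d l] being the partial derivative along the l-th coordinate. *)
Definition contr T d (i : 'I_n) : 'M[C]_n := \sum_l T i l *: d l.

(** One operation serves for type projections, for rotation by a complex structure and for raising
    indices, according to the matrices placed in the three slots. *)
Definition act3 X Y Z (t : 'I_n -> 'I_n -> 'I_n -> C) i j k : C :=
  \sum_a \sum_b \sum_c X i a * Y j b * Z k c * t a b c.

Lemma contr_mulmxl T X d i : contr (T *m X) d i = \sum_l T i l *: contr X d l.
Proof.
rewrite /contr; under eq_bigr do rewrite mxE scaler_suml.
rewrite exchange_big; apply: eq_bigr => l _; rewrite scaler_sumr.
by apply: eq_bigr => m _; rewrite scalerA.
Qed.

Lemma contrM T d X Y i : contr T (fun l => X *m d l *m Y) i = X *m contr T d i *m Y.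
Proof.
rewrite /contr mulmx_sumr mulmx_suml; apply: eq_bigr => l _.
by rewrite -scalemxAr scalemxAl.
Qed.

Lemma contrMr T d Y i : contr T (fun l => d l *m Y) i = contr T d i *m Y.
Proof.
by rewrite /contr mulmx_suml; apply: eq_bigr => l _; rewrite scalemxAl.
Qed.

Lemma contrMl T d X i : contr T (fun l => X *m d l) i = X *m contr T d i.
Proof.
by rewrite /contr mulmx_sumr; apply: eq_bigr => l _; rewrite scalemxAr.
Qed.

Lemma contrD T d d' i : contr T (fun l => d l + d' l) i = contr T d i + contr T d' i.
Proof. by rewrite /contr -big_split; apply: eq_bigr => l _; rewrite scalerDr. Qed.

Lemma contrZ T d c i : contr T (fun l => c *: d l) i = c *: contr T d i.
Proof. by rewrite /contr scaler_sumr; apply: eq_bigr => l _; rewrite !scalerA mulrC. Qed.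

Lemma contrZl T d c i : contr (c *: T) d i = c *: contr T d i.
Proof. by rewrite /contr scaler_sumr; apply: eq_bigr => l _; rewrite mxE scalerA. Qed.

Lemma contr_tr T d i : contr T (fun l => (d l)^T) i = (contr T d i)^T.
Proof. by rewrite /contr raddf_sum; apply: eq_bigr => l _; rewrite /= linearZ. Qed.

Lemma contr0 T i : contr T (fun=> 0) i = 0.
Proof. by rewrite /contr big1// => l _; rewrite scaler0. Qed.

Lemma eq_contr T d d' : d =1 d' -> contr T d =1 contr T d'.
Proof. by move=> e i; apply: eq_bigr => l _; rewrite e. Qed.

Lemma contrE T d i j k : contr T d i j k = \sum_l T i l * d l j k.
Proof. by rewrite /contr summxE; apply: eq_bigr => l _; rewrite mxE. Qed.

(* The vanishing of the Nijenhuis tensor on the coordinate fields a and b. *)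
Definition integrable_jet A dA :=
  forall a b, row b (contr A dA a) - row a (contr A dA b)
            = row b (dA a *m A) - row a (dA b *m A).

Lemma mulmx_row_sum T X i : row i (T *m X) = \sum_a T i a *: row a X.
Proof.
apply/rowP => k; rewrite !mxE summxE; apply: eq_bigr => a _; by rewrite !mxE.
Qed.

Lemma row_sumE (I : finType) (F : I -> 'M[C]_n) i : row i (\sum_a F a) = \sum_a row i (F a).
Proof. by rewrite raddf_sum. Qed.

(** The integrability condition is bilinear in the two coordinate fields, so summing it against
    [T i a * T j b] transfers it to the rows [i] and [j] of [T]. *)
Lemma integrable_contr A dA T i j : integrable_jet A dA ->
  row j (T *m contr (T *m A) dA i) - row i (T *m contr (T *m A) dA j)
  = row j (T *m contr T dA i *m A) - row i (T *m contr T dA j *m A).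
Proof.
move=> nA.
have E1 p q d : row q (T *m contr T d p) =
    \sum_a \sum_b (T p a * T q b) *: row b (d a).
  rewrite mulmx_row_sum exchange_big; apply: eq_bigr => b _.
  rewrite /contr row_sumE scaler_sumr; apply: eq_bigr => a _.
  by rewrite linearZ scalerA mulrC.
have E2 p : contr (T *m A) dA p = contr T (contr A dA) p.
  exact: contr_mulmxl.
rewrite -!mulmxA -!contrMr !E2 !E1.
rewrite [X in _ - X]exchange_big [in RHS]/= [X in _ = _ - X]exchange_big /=.
rewrite -!sumrB; apply: eq_bigr => a _; rewrite -!sumrB; apply: eq_bigr => b _.
by rewrite [T j b * _]mulrC -!scalerBr nA.
Qed.

Section Eigen.
Context (lam : C) (lam2 : lam * lam = -1).

Lemma mulIlam2 (V : lmodType C) (v : V) : lam *: v = - (lam *: v) -> v = 0.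
Proof.
move=> /eqP; rewrite -addr_eq0 -mulr2n -scaler_nat scalerA => /eqP e.
apply: (scalerI (a := 2%:R * lam)); last by rewrite e scaler0.
rewrite mulf_neq0 ?pnatr_eq0//; apply/eqP => l0.
by move: lam2; rewrite l0 mul0r => /eqP; rewrite eq_sym oppr_eq0 oner_eq0.
Qed.

Context (A : 'M[C]_n) (dA : 'I_n -> 'M[C]_n).
Hypothesis dA2 : forall l, dA l *m A + A *m dA l = 0.
Hypothesis nA : integrable_jet A dA.

(** Involutivity of the eigenbundle spanned by the rows of [T]. Differentiating [A *m A = - 1%:M]
    makes [dA] anticommute with [A], so in [integrable_contr] the left side is [lam] times the
    difference of the two rows and the right side is [- lam] times it. *)
Lemma eigen_torsion T i j : T *m A = lam *: T ->
  row j (T *m contr T dA i) = row i (T *m contr T dA j).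
Proof.
move=> TA; apply/eqP; rewrite -subr_eq0; apply/eqP/mulIlam2.
have := integrable_contr T i j nA.
rewrite TA !contrZl -!scalemxAr !linearZ /= -scalerDr => ->.
have E p : T *m contr T dA p *m A = - (lam *: (T *m contr T dA p)).
  rewrite -mulmxA -contrMr (eq_contr _ (d' := fun l => (-1) *: (A *m dA l))).
    by rewrite contrZ contrMl -scalemxAr mulmxA TA -scalemxAl scaleN1r.
  by move=> l; apply/eqP; rewrite scaleN1r -addr_eq0 dA2.
by rewrite !E !linearN !linearZ /= -scalerDr opprB opprK addrC scalerBr.
Qed.

End Eigen.

Definition dform dw i j k : C := dw i j k - dw j i k + dw k i j.

Lemma eq_act3 X Y Z t t' i j k : (forall a b c, t a b c = t' a b c) ->
  act3 X Y Z t i j k = act3 X Y Z t' i j k.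
Proof.
by move=> e; do 3!(apply: eq_bigr => ? _); rewrite e.
Qed.

Lemma act3_swap X Y Z t i j k :
  act3 X Y Z (fun a b c => t b a c) i j k = act3 Y X Z t j i k.
Proof.
rewrite /act3 exchange_big; do 3!(apply: eq_bigr => ? _).
by rewrite [X i _ * _]mulrC.
Qed.

Lemma act3_rot X Y Z t i j k :
  act3 X Y Z (fun a b c => t c a b) i j k = act3 Z X Y t k i j.
Proof.
rewrite /act3.
under eq_bigr do rewrite exchange_big.
rewrite exchange_big; do 3!(apply: eq_bigr => ? _).
by congr (_ * _); rewrite mulrC mulrA.
Qed.

Lemma act3D X Y Z t t' i j k : act3 X Y Z (fun a b c => t a b c + t' a b c) i j k
  = act3 X Y Z t i j k + act3 X Y Z t' i j k.
Proof.
rewrite /act3 -big_split; apply: eq_bigr => a _; rewrite -big_split.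
apply: eq_bigr => b _; rewrite -big_split; apply: eq_bigr => c _.
by rewrite mulrDr.
Qed.

Lemma act3N X Y Z t i j k :
  act3 X Y Z (fun a b c => - t a b c) i j k = - act3 X Y Z t i j k.
Proof.
rewrite /act3 -sumrN; apply: eq_bigr => a _; rewrite -sumrN.
apply: eq_bigr => b _; rewrite -sumrN; apply: eq_bigr => c _.
by rewrite mulrN.
Qed.

Lemma act3_contr X Y Z d i j k :
  act3 X Y Z (fun a b c => d a b c) i j k = (Y *m contr X d i *m Z^T) j k.
Proof.
rewrite /act3 exchange_big -mulmxA mxE; apply: eq_bigr => b _.
rewrite exchange_big mxE mulr_sumr; apply: eq_bigr => c _ /=.
rewrite contrE mxE mulr_suml mulr_sumr; apply: eq_bigr => a _ /=.
ring.
Qed.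

Lemma act3_dform T dw i j k : act3 T T T (dform dw) i j k =
  (T *m contr T dw i *m T^T) j k - (T *m contr T dw j *m T^T) i k
  + (T *m contr T dw k *m T^T) i j.
Proof.
rewrite act3D act3D act3N -!act3_contr.
by rewrite (act3_swap _ _ _ (fun a b c => dw a b c)) (act3_rot _ _ _ (fun a b c => dw a b c)).
Qed.

Lemma act3_comp X Y Z X' Y' Z' t i j k :
  act3 X Y Z (act3 X' Y' Z' t) i j k = act3 (X *m X') (Y *m Y') (Z *m Z') t i j k.
Proof.
have dist1 (c : C) (F : 'I_n -> C) : c * \sum_a F a = \sum_a c * F a by rewrite mulr_sumr.
rewrite /act3.
transitivity (\sum_a \sum_b \sum_c \sum_a0 \sum_b0 \sum_c0
   (X i a * X' a a0) * (Y j b * Y' b b0) * (Z k c * Z' c c0) * t a0 b0 c0).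
  do 3!(apply: eq_bigr => ? _; rewrite ?dist1).
  do 3!(apply: eq_bigr => ? _; rewrite ?dist1).
  ring.
transitivity (\sum_a0 \sum_b0 \sum_c0 \sum_a \sum_b \sum_c
   (X i a * X' a a0) * (Y j b * Y' b b0) * (Z k c * Z' c c0) * t a0 b0 c0).
  pose F a b c a0 b0 c0 := (X i a * X' a a0) * (Y j b * Y' b b0) * (Z k c * Z' c c0) * t a0 b0 c0.
  (* Moving the fourth summation to the front, three times in a row, brings all inner indices
     outside. *)
  have ex (G : 'I_n -> 'I_n -> 'I_n -> 'I_n -> C) :
     \sum_a \sum_b \sum_c \sum_d G a b c d = \sum_d \sum_a \sum_b \sum_c G a b c d.
    under eq_bigr do under eq_bigr do rewrite exchange_big.
    under eq_bigr do rewrite exchange_big.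
    by rewrite exchange_big.
  rewrite (ex (fun a b c a0 => \sum_b0 \sum_c0 F a b c a0 b0 c0)); apply: eq_bigr => a0 _.
  rewrite (ex (fun a b c b0 => \sum_c0 F a b c a0 b0 c0)); apply: eq_bigr => b0 _.
  by rewrite (ex (fun a b c c0 => F a b c a0 b0 c0)).
apply: eq_bigr => a0 _; apply: eq_bigr => b0 _; apply: eq_bigr => c0 _.
rewrite !mxE -2![RHS]mulrA mulr_suml; apply: eq_bigr => a _ /=.
rewrite mulr_suml mulr_sumr; apply: eq_bigr => b _ /=.
rewrite mulr_suml !mulr_sumr; apply: eq_bigr => c _; ring.
Qed.

Lemma act3_1 t i j k : act3 1%:M 1%:M 1%:M t i j k = t i j k.
Proof.
rewrite /act3 (bigD1 i)//= [X in _ + X]big1 => [|a ai].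
  rewrite addr0 (bigD1 j)//= [X in _ + X]big1 => [|b bj].
    rewrite addr0 (bigD1 k)//= [X in _ + X]big1 => [|c ck].
      by rewrite !mxE !eqxx addr0 !mul1r.
    by rewrite !mxE [k == c]eq_sym (negbTE ck) mulr0 mul0r.
  by rewrite big1// => c _; rewrite !mxE [j == b]eq_sym (negbTE bj) mulr0 !mul0r.
by rewrite big1// => b _; rewrite big1// => c _; rewrite !mxE [i == a]eq_sym (negbTE ai) !mul0r.
Qed.

Lemma act3DX X X' Y Z t i j k :
  act3 (X + X') Y Z t i j k = act3 X Y Z t i j k + act3 X' Y Z t i j k.
Proof.
rewrite /act3 -big_split; apply: eq_bigr => a _; rewrite -big_split.
apply: eq_bigr => b _; rewrite -big_split; apply: eq_bigr => c _.
by rewrite !mxE !mulrDl.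
Qed.

Lemma act3DY X Y Y' Z t i j k :
  act3 X (Y + Y') Z t i j k = act3 X Y Z t i j k + act3 X Y' Z t i j k.
Proof. by rewrite -!(act3_swap _ _ _ t) act3DX. Qed.

Lemma act3DZ X Y Z Z' t i j k :
  act3 X Y (Z + Z') t i j k = act3 X Y Z t i j k + act3 X Y Z' t i j k.
Proof. 
have R W : act3 X Y W t i j k = act3 W X Y (fun c a b => t a b c) k i j.
  exact: (act3_rot _ _ _ (fun c a b => t a b c)).
by rewrite !R act3DX. Qed.

Lemma act3ZX c X Y Z t i j k : act3 (c *: X) Y Z t i j k = c * act3 X Y Z t i j k.
Proof.
rewrite /act3 mulr_sumr; apply: eq_bigr => a _; rewrite mulr_sumr.
apply: eq_bigr => b _; rewrite mulr_sumr; apply: eq_bigr => d _ /=.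
by rewrite !mxE !mulrA.
Qed.

Lemma act3ZY c X Y Z t i j k : act3 X (c *: Y) Z t i j k = c * act3 X Y Z t i j k.
Proof. by rewrite -!(act3_swap _ _ _ t) act3ZX. Qed.

Lemma act3ZZ c X Y Z t i j k : act3 X Y (c *: Z) t i j k = c * act3 X Y Z t i j k.
Proof. 
have R W : act3 X Y W t i j k = act3 W X Y (fun c a b => t a b c) k i j.
  exact: (act3_rot _ _ _ (fun c a b => t a b c)).
by rewrite !R act3ZX. Qed.

End Jets.

(** * Forms of type (1,1): the exterior derivative and its rotation *)

Section Hermitian.
Context {C : numFieldType} {n : nat}.
Context (A w : 'M[C]_n) (dA dw : 'I_n -> 'M[C]_n).
Hypothesis A2 : A *m A = - 1%:M.
Hypothesis dA2 : forall l, dA l *m A + A *m dA l = 0.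
Hypothesis nA : integrable_jet A dA.
Hypothesis Aw : A *m w = - (w *m A^T).
Hypothesis dAw : forall l,
  dA l *m w + A *m dw l = - (dw l *m A^T + w *m (dA l)^T).
Hypothesis wT : w^T = - w.

(* [T] is twice the projection onto the [lam]-eigenspace of [A]: for
   [lam = i] this says that [dw] has no (3,0) part. *)
Lemma act3_eigen_dform (lam : C) i j k : lam * lam = -1 ->
  act3 (1%:M - lam *: A) (1%:M - lam *: A) (1%:M - lam *: A) (dform dw) i j k = 0.
Proof.
move=> lam2; set T := _ - _.
have TA : T *m A = lam *: T.
  rewrite mulmxBl mul1mx -scalemxAl A2 scalerBr scalerA lam2 scaleN1r scalerN.
  by rewrite !opprK addrC.
have TT : T^T = 1%:M - lam *: A^T by rewrite linearB /= trmx1 linearZ.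
(* Moving [T^T] across [w] conjugates it, and moving the result across [B], which anticommutes with
   [A], conjugates it back. *)
have T1 (B : 'M[C]_n) : B *m A + A *m B = 0 -> B *m w *m T^T = T *m B *m w.
  move=> /eqP; rewrite addr_eq0 => /eqP BA.
  rewrite TT mulmxBr mulmx1 -scalemxAr -[_ *m A^T]mulmxA.
  rewrite -[w *m A^T]opprK -Aw mulmxN mulmxA BA mulNmx opprK.
  by rewrite !mulmxBl mul1mx -!scalemxAl.
(* This is the derivative of [T *m w *m T^T = 0], where [T] has derivative [- lam *: dA]. It is
   obtained entrywise by combining [dAw] with its product by [A]. *)
have TdwT l : T *m dw l *m T^T = lam *: (dA l *m w *m T^T - (dA l *m w *m T^T)^T).
  have h1 := dAw l; have h2 := congr1 (mulmx A) (dAw l).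
  rewrite mulmxDr mulmxN mulmxDr !mulmxA A2 mulNmx mul1mx in h2.
  have h3 : A *m dA l *m w = dA l *m w *m A^T.
    rewrite -[dA l *m w *m _]mulmxA -[w *m A^T]opprK -Aw mulmxN mulmxA -mulNmx.
    by congr (_ *m w); apply/eqP; rewrite -addr_eq0 addrC dA2.
  rewrite h3 in h2.
  rewrite [(_ *m T^T)^T]trmx_mul trmxK trmx_mul wT mulNmx mulmxN opprK.
  rewrite TT /T !mulmxBl !mulmxBr !mul1mx !mulmx1.
  rewrite -!scalemxAr -!scalemxAl !mulmxA.
  move: h1 h2; set m1 := _ *m w; set m2 := A *m _; set m3 := _ *m A^T.
  set m4 := w *m _; set m5 := _ *m A^T; set m6 := _ *m A^T; set m7 := _ *m _^T.
  move=> {}h1 {}h2; apply/matrixP => p q.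
  move: (congr1 (fun X : 'M[C]_n => X p q) h1) (congr1 (fun X : 'M[C]_n => X p q) h2).
  move: (m1) (m2) (m3) (m4) (m5) (m6) (m7) => a1 a2 a3 a4 a5 a6 a7.
  rewrite !mxE => {}h1 {}h2.
  apply/eqP; rewrite -subr_eq0; apply/eqP.
  transitivity (- lam * ((a1 p q + a2 p q) + (a3 p q + a4 p q))
    - ((a5 p q - dw l p q) + (a6 p q + a7 p q))
    + (lam * lam + 1) * (a5 p q + (a6 p q + a7 p q))); first by ring.
  by rewrite h1 h2 lam2 !addNr mulr0 subrr mul0r addr0.
(* Involutivity gives a symmetry in the first two slots; under it the six terms of [dform] cancel in
   pairs. *)
have X i' j' : row j' (contr T dA i' *m w *m T^T) = row i' (contr T dA j' *m w *m T^T).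
  have cA p : contr T dA p *m A + A *m contr T dA p = 0.
    by rewrite -contrMr -contrMl -contrD (eq_contr _ dA2) contr0.
  by rewrite !T1// row_mul (eigen_torsion lam2 dA2 nA _ _ TA) -row_mul.
have E p : T *m contr T dw p *m T^T = 
   lam *: (contr T dA p *m w *m T^T - (contr T dA p *m w *m T^T)^T).
  rewrite -contrM (eq_contr _ TdwT) contrZ; congr (_ *: _).
  rewrite -!contrMr -contr_tr -[X in _ + X]scaleN1r -contrZ -contrD.
  by apply: eq_contr => l; rewrite scaleN1r.
have X' p q r : (contr T dA p *m w *m T^T) q r = (contr T dA q *m w *m T^T) p r.
  by have /rowP/(_ r) := X p q; rewrite !mxE.
have E' p q r : (T *m contr T dw p *m T^T) q r = lam *
    ((contr T dA p *m w *m T^T) q r - (contr T dA p *m w *m T^T) r q).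
  by rewrite E; move: (contr T dA p *m w *m T^T) => Y; rewrite !mxE.
rewrite act3_dform !E' (X' j i k) (X' k i j) (X' k j i); ring.
Qed.

(** Without (3,0) and (0,3) parts, [dw] has types (2,1) and (1,2) only. Evaluating on [A]-rotated
    vectors multiplies the first by [lam * lam * (- lam) = lam] and the second by [- lam], which is
    the operator on the left up to sign. *)
Lemma dc_jet lam i j k : lam * lam = -1 ->
  let t := 2%:R^-1 *: (1%:M - lam *: A) in
  let f := 2%:R^-1 *: (1%:M + lam *: A) in
  let e X Y Z := act3 X Y Z (dform dw) i j k in
  lam * ((e f f t + e f t f + e t f f) - (e t t f + e t f t + e f t t)) = - e A A A.
Proof.
move=> lam2 t f e.
have eD X X' Y Z : e (X + X') Y Z = e X Y Z + e X' Y Z by exact: act3DX.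
have eDY X Y Y' Z : e X (Y + Y') Z = e X Y Z + e X Y' Z by exact: act3DY.
have eDZ X Y Z Z' : e X Y (Z + Z') = e X Y Z + e X Y Z' by exact: act3DZ.
have eZX c X Y Z : e (c *: X) Y Z = c * e X Y Z by exact: act3ZX.
have eZY c X Y Z : e X (c *: Y) Z = c * e X Y Z by exact: act3ZY.
have eZZ c X Y Z : e X Y (c *: Z) = c * e X Y Z by exact: act3ZZ.
have mE nu : 1%:M - nu *: A = 1%:M + (- nu) *: A by rewrite scaleNr.
(* Used for [mu = lam] and [mu = - lam]: the difference of the two equations isolates the terms odd
   in [A], which is [e3]. *)
have e0 mu : mu * mu = -1 -> e 1%:M 1%:M 1%:M
    - mu * (e A 1%:M 1%:M + e 1%:M A 1%:M + e 1%:M 1%:M A)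
    - (e A A 1%:M + e A 1%:M A + e 1%:M A A) + mu * e A A A = 0.
  move=> mu2; rewrite -[RHS](act3_eigen_dform i j k mu2) -/(e _ _ _) !mE.
  rewrite !(eD, eDY, eDZ, eZX, eZY, eZZ).
  apply/eqP; rewrite -subr_eq0; apply/eqP.
  transitivity (- (mu * mu + 1) * (e A A 1%:M + e A 1%:M A + e 1%:M A A - mu * e A A A)).
    ring.
  by rewrite mu2 addNr oppr0 mul0r.
have lam2N : (- lam) * (- lam) = -1 by rewrite mulrNN.
have e3 : e A A A = e A 1%:M 1%:M + e 1%:M A 1%:M + e 1%:M 1%:M A.
  have l0 : 2%:R * lam != 0.
    rewrite mulf_neq0 ?pnatr_eq0//; apply/eqP => l0; move/eqP: lam2.
    by rewrite l0 mul0r eq_sym oppr_eq0 oner_eq0.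
  apply: (mulfI l0); apply/eqP; rewrite -subr_eq0; apply/eqP.
  rewrite -[RHS](subrr 0) -{1}(e0 _ lam2) -(e0 _ lam2N); ring.
rewrite /t /f mE !(eD, eDY, eDZ, eZX, eZY, eZZ).
have h2 : 2%:R^-1 * 2%:R = 1 :> C by rewrite mulVf// pnatr_eq0.
move: (2%:R^-1) h2 => h h2.
transitivity (h * h * h * (2%:R * (lam * lam) * (e A 1%:M 1%:M + e 1%:M A 1%:M + e 1%:M 1%:M A)
   - 6%:R * (lam * lam) * (lam * lam) * e A A A)).
  ring.
rewrite -e3 lam2.
transitivity (- (h * 2%:R) * (h * 2%:R) * (h * 2%:R) * e A A A); first by ring.
by rewrite !mulNr h2 !mul1r.
Qed.
End Hermitian.

(** * Schouten brackets of 1-jets *)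

Section Schouten.
Context {C : numFieldType} {n : nat}.
Implicit Types (P Q : 'M[C]_n) (dP dQ dw : 'I_n -> 'M[C]_n).

Definition sch_jet P Q dP dQ i j k : C :=
  let t i j k := \sum_l (P i l * dQ l j k + Q i l * dP l j k) in
  t i j k + t j k i + t k i j.

Lemma sch_jetE P Q dP dQ i j k : sch_jet P Q dP dQ i j k =
  (contr P dQ i j k + contr Q dP i j k) + (contr P dQ j k i + contr Q dP j k i)
  + (contr P dQ k i j + contr Q dP k i j).
Proof. by rewrite /sch_jet !contrE !big_split. Qed.

(** Differentiating [w *m P = 1%:M] gives [dP = - P dw P], that is [P dw P^T] by skewness; the
    remaining [P] in the bracket raises the index of differentiation. The factor 2 comes from the
    two equal halves of the bracket of [P] with itself. *)
Lemma sch_jet_dual P w dP dw i j k :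
  P^T = - P -> (forall l, (dP l)^T = - dP l) ->
  w *m P = 1%:M -> (forall l, dw l *m P + w *m dP l = 0) ->
  sch_jet P P dP dP i j k = 2%:R * act3 P P P (dform dw) i j k.
Proof.
move=> PT dPT wP dwP.
have Pw : P *m w = 1%:M by exact: mulmx1C.
have dPE l : dP l = P *m dw l *m P^T.
  have /(congr1 (mulmx P)) := dwP l.
  rewrite mulmxDr !mulmxA Pw mul1mx mulmx0 => /eqP.
  by rewrite addrC addr_eq0 PT mulmxN => /eqP.
have E p : contr P dP p = P *m contr P dw p *m P^T.
  by rewrite (eq_contr _ dPE) contrM.
have N p q r : contr P dP p q r = - contr P dP p r q.
  have : (contr P dP p)^T = - contr P dP p.
    rewrite -contr_tr -scaleN1r -contrZ; apply: eq_contr => l.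
    by rewrite scaleN1r dPT.
  by move/matrixP/(_ r q); rewrite !mxE.
by rewrite sch_jetE act3_dform -!E (N j i k); ring.
Qed.

(* [Q *m A = lam *: Q] says that [Q] is of type (2,0), the conclusion that its
   bracket is of type (3,0). *)
Lemma sch_jet_eigen (lam : C) (A Q : 'M[C]_n) (dA dQ : 'I_n -> 'M[C]_n) i j m :
  lam * lam = -1 ->
  (forall l, dA l *m A + A *m dA l = 0) -> integrable_jet A dA ->
  Q^T = - Q -> (forall l, (dQ l)^T = - dQ l) ->
  Q *m A = lam *: Q -> (forall l, dQ l *m A + Q *m dA l = lam *: dQ l) ->
  \sum_k sch_jet Q Q dQ dQ i j k * A k m = lam * sch_jet Q Q dQ dQ i j m.
Proof.
move=> lam2 dA2 nA QT dQT QA dQA.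
have N p q r : contr Q dQ p q r = - contr Q dQ p r q.
  have : (contr Q dQ p)^T = - contr Q dQ p.
    rewrite -contr_tr -scaleN1r -contrZ; apply: eq_contr => l.
    by rewrite scaleN1r dQT.
  by move/matrixP/(_ r q); rewrite !mxE.
have DA p q r : \sum_k contr Q dQ p q k * A k r =
    lam * contr Q dQ p q r - (Q *m contr Q dA p) q r.
  have -> : \sum_k contr Q dQ p q k * A k r = (contr Q dQ p *m A) q r by rewrite mxE.
  rewrite -contrMr (eq_contr _ (d' := fun l => lam *: dQ l + (-1) *: (Q *m dA l))).
    rewrite contrD !contrZ contrMl.
    by move: (contr _ _ _) (Q *m _) => X Y; rewrite !mxE mulN1r.
  by move=> l; rewrite -dQA scaleN1r addrK.
(* Here the rotated index lies in the undifferentiated factor, so skewness and the eigenvalue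
   equation of [Q] suffice and no derivative of [A] appears. *)
have T3 : \sum_k contr Q dQ k i j * A k m = lam * contr Q dQ m i j.
  under eq_bigr do rewrite contrE mulr_suml.
  rewrite exchange_big contrE mulr_sumr; apply: eq_bigr => l _.
  have QA' : \sum_a Q l a * A a m = lam * Q l m.
    by have /matrixP/(_ l m) := QA; rewrite !mxE.
  have QN a b : Q a b = - Q b a by have /matrixP/(_ b a) := QT; rewrite !mxE.
  rewrite mulrA (QN m l) mulrN -QA' -sumrN mulr_suml.
  by apply: eq_bigr => a _; rewrite (QN a l); ring.
(* The terms in [dA] left by [DA] occur with opposite signs for [i] and [j]; involutivity makes them
   equal, so they cancel. *)
have X : (Q *m contr Q dA i) j m = (Q *m contr Q dA j) i m.
  have /rowP/(_ m) := eigen_torsion lam2 dA2 nA i j QA.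
  by rewrite [LHS]mxE [RHS]mxE.
under eq_bigr do rewrite sch_jetE (N j _ i) !mulrDl !mulNr.
rewrite !big_split /= !sumrN !DA !T3 X sch_jetE (N j m i); ring.
Qed.

Lemma contrDl T T' d i : contr (T + T') d i = contr T d i + contr T' d i :> 'M[C]_n.
Proof. by rewrite /contr -big_split; apply: eq_bigr => l _; rewrite mxE scalerDl. Qed.

Lemma sch_jetC P Q dP dQ i j k : sch_jet P Q dP dQ i j k = sch_jet Q P dQ dP i j k.
Proof. rewrite !sch_jetE; ring. Qed.

Lemma sch_jetDl P Q R dP dQ dR i j k :
  sch_jet (P + Q) R (fun l => dP l + dQ l) dR i j k =
  sch_jet P R dP dR i j k + sch_jet Q R dQ dR i j k.
Proof.
rewrite !sch_jetE !contrDl !contrD.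
rewrite ![((_ + _ : 'M[C]_n) _ _)]mxE; ring.
Qed.

Lemma sch_jetZl c P R dP dR i j k :
  sch_jet (c *: P) R (fun l => c *: dP l) dR i j k = c * sch_jet P R dP dR i j k.
Proof.
rewrite !sch_jetE !contrZl !contrZ.
rewrite ![((_ *: _ : 'M[C]_n) _ _)]mxE; ring.
Qed.

Lemma sch_jetDr P Q R dP dQ dR i j k :
  sch_jet R (P + Q) dR (fun l => dP l + dQ l) i j k =
  sch_jet R P dR dP i j k + sch_jet R Q dR dQ i j k.
Proof. by rewrite sch_jetC sch_jetDl !(sch_jetC R). Qed.

Lemma sch_jetZr c P R dP dR i j k :
  sch_jet R (c *: P) dR (fun l => c *: dP l) i j k = c * sch_jet R P dR dP i j k.
Proof. by rewrite sch_jetC sch_jetZl (sch_jetC R). Qed.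

Lemma contr_suml (I : finType) (T : I -> 'M[C]_n) d i :
  contr (\sum_s T s) d i = \sum_s contr (T s) d i.
Proof.
rewrite /contr exchange_big; apply: eq_bigr => l _.
by rewrite summxE scaler_suml.
Qed.

Lemma contr_sumr (I : finType) T (d : I -> 'I_n -> 'M[C]_n) i :
  contr T (fun l => \sum_s d s l) i = \sum_s contr T (d s) i.
Proof.
by rewrite /contr exchange_big; apply: eq_bigr => l _; rewrite scaler_sumr.
Qed.

Lemma sch_jet_suml (I : finType) (P : I -> 'M[C]_n) (dP : I -> 'I_n -> 'M[C]_n) R dR i j k :
  sch_jet (\sum_s P s) R (fun l => \sum_s dP s l) dR i j k =
  \sum_s sch_jet (P s) R (dP s) dR i j k.
Proof.
under [RHS]eq_bigr do rewrite sch_jetE.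
by rewrite sch_jetE !contr_suml !contr_sumr !summxE -!big_split.
Qed.

Lemma sch_jet_comb (I : finType) (q : I -> C) (P : I -> 'M[C]_n) (dP : I -> 'I_n -> 'M[C]_n) i j k :
  sch_jet (\sum_s q s *: P s) (\sum_s q s *: P s)
    (fun l => \sum_s q s *: dP s l) (fun l => \sum_s q s *: dP s l) i j k =
  \sum_s \sum_t q s * q t * sch_jet (P s) (P t) (dP s) (dP t) i j k.
Proof.
rewrite (sch_jet_suml _ (fun s l => q s *: dP s l)); apply: eq_bigr => s _.
rewrite sch_jetC (sch_jet_suml _ (fun s l => q s *: dP s l)); apply: eq_bigr => t _.
by rewrite sch_jetZl sch_jetZr sch_jetC mulrA [q t * _]mulrC.
Qed.

Definition sch_jet_lin := (@sch_jetDl, @sch_jetDr, @sch_jetZl, @sch_jetZr).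

(** For either root [lam], [P - lam *: Q] is a [lam]-eigenbivector of [A]. Equal diagonal brackets
    reduce its bracket with itself to [- 2 lam] times the mixed one. The mixed bracket, rotated in
    its last slot, is thus multiplied by [iota] and also by [- iota], so it is zero. *)
Lemma sch_jet_mixed (iota : C) (A P Q : 'M[C]_n) (dA dP dQ : 'I_n -> 'M[C]_n) :
  iota * iota = -1 ->
  (forall l, dA l *m A + A *m dA l = 0) -> integrable_jet A dA ->
  P^T = - P -> (forall l, (dP l)^T = - dP l) ->
  Q^T = - Q -> (forall l, (dQ l)^T = - dQ l) ->
  P *m A = Q -> (forall l, dP l *m A + P *m dA l = dQ l) -> A *m A = - 1%:M ->
  (forall i j k, sch_jet P P dP dP i j k = sch_jet Q Q dQ dQ i j k) ->
  forall i j k, sch_jet P Q dP dQ i j k = 0.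
Proof.
move=> iota2 dA2 nA PT dPT QT dQT PA dPA A2 PQ i j k.
have QA : Q *m A = - P by rewrite -PA -mulmxA A2 mulmxN mulmx1.
have dQA l : dQ l *m A + Q *m dA l = - dP l.
  rewrite -dPA -PA mulmxDl -(mulmxA (dP l)) A2 mulmxN mulmx1 -addrA.
  by rewrite -!(mulmxA P) -mulmxDr dA2 mulmx0 addr0.
have E (lam : C) m : lam * lam = -1 ->
    - lam * \sum_k sch_jet P Q dP dQ i j k * A k m = sch_jet P Q dP dQ i j m.
  move=> lam2.
  have two : 2%:R != 0 :> C by rewrite pnatr_eq0.
  have S p : sch_jet (P + (- lam) *: Q) (P + (- lam) *: Q)
      (fun l => dP l + (- lam) *: dQ l) (fun l => dP l + (- lam) *: dQ l) i j p =
      - 2%:R * lam * sch_jet P Q dP dQ i j p.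
    rewrite !sch_jet_lin PQ (sch_jetC Q P).
    transitivity ((lam * lam + 1) * sch_jet Q Q dQ dQ i j p - 2%:R * lam * sch_jet P Q dP dQ i j p).
      ring.
    by rewrite lam2 addNr mul0r add0r !mulNr.
  apply: (mulfI two).
  have := @sch_jet_eigen lam A (P + (- lam) *: Q) dA (fun l => dP l + (- lam) *: dQ l)
    i j m lam2 dA2 nA.
  under eq_bigr do rewrite S -[_ * sch_jet P Q dP dQ i j _ * _]mulrA.
  rewrite S -mulr_sumr => e.
  transitivity (- 2%:R * lam * \sum_k sch_jet P Q dP dQ i j k * A k m).
    by ring.
  rewrite e.
  - transitivity (- (lam * lam) * (2%:R * sch_jet P Q dP dQ i j m)); first by ring.
    by rewrite lam2 opprK mul1r.
  - by rewrite linearD linearZ /= PT QT scalerN opprD.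
  - by move=> l; rewrite linearD linearZ /= dPT dQT scalerN opprD.
  - rewrite mulmxDl -scalemxAl PA QA scalerDr scalerA scalerN -scaleNr opprK.
    by rewrite mulrN lam2 opprK scale1r addrC.
  - move=> l; rewrite !mulmxDl -!scalemxAl addrACA dPA -scalerDr dQA.
    by rewrite scalerDr scalerA scalerN -scaleNr opprK mulrN lam2 opprK scale1r addrC.
have iota2N : (- iota) * (- iota) = -1 by rewrite mulrNN.
have := E _ k iota2N; rewrite opprK => e.
have /eqP := E _ k iota2; rewrite mulNr e -subr_eq0 -opprD oppr_eq0 -mulr2n.
by rewrite -mulr_natl mulf_eq0 pnatr_eq0 /= => /eqP.
Qed.

End Schouten.

(** * Smooth functions *)

(** The little-o estimate at [x] sees only nearby points, so the differential of [f] serves for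
    [g]. *)
Lemma near_eq_differentiable (R : numFieldType) (V W : normedModType R)
    (f g : V -> W) (x : V) :
  (\near x, f x = g x) -> differentiable f x -> differentiable g x.
Proof.
move=> fg /diff_locallyP[dfc /eqaddoP dfx].
have fgx : f x = g x by exact: nbhs_singleton fg.
have dg : g \o shift x = cst (g x) + 'd f x +o_ 0 id.
  apply/eqaddoP => e e0; apply: filterS2 (dfx e e0) ((nbhs0P _ _).1 fg) => h.
  rewrite fgx !fctE /= => + fgh.
  by rewrite [h + x]addrC fgh.
by apply/diff_locallyP; have -> // : 'd g x = 'd f x :> (V -> W) by exact: diff_unique.
Qed.

Section Smooth.
Context {R : realType} {n : nat}.
Implicit Types (U : set 'rV[R]_n) (f g : 'rV[R]_n -> R).

Lemma partial_near_eq U f g i u : open U -> U u -> (forall v, U v -> f v = g v) ->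
  partial i f u = partial i g u.
Proof.
move=> oU Uu fg; apply: near_eq_derive.
by apply: filterS (open_nbhs_nbhs (conj oU Uu)).
Qed.

Lemma smooth_differentiable U f u : smooth_on U f -> U u -> differentiable f u.
Proof. by move=> sf Uu; exact: (sf [::]). Qed.

Lemma smooth_partial U f i : smooth_on U f -> smooth_on U (partial i f).
Proof.
move=> sf s u Uu; have := sf (rcons s i) u Uu.
by rewrite /iter_partial foldr_rcons.
Qed.

(** Formulas for derivatives hold only on [U], while [smooth_on] iterates the derivatives of the
    function itself. Closure under partial derivatives up to equality on [U] still suffices, because
    [U] is open and such an equality survives further differentiation. *)
Lemma smooth_coinduction U (F : ('rV[R]_n -> R) -> Prop) : open U ->
  (forall f, F f -> forall u, U u -> differentiable f u) ->
  (forall f, F f -> forall i, exists2 g, F g & forall u, U u -> partial i f u = g u) ->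
  forall f, F f -> smooth_on U f.
Proof.
move=> oU dF pF f Ff s.
suff [g Fg fg] : exists2 g, F g & forall u, U u -> iter_partial s f u = g u.
  move=> u Uu; apply: near_eq_differentiable (dF g Fg u Uu).
  by apply: filterS (open_nbhs_nbhs (conj oU Uu)) => v Uv; rewrite fg.
elim: s => [|i s [g Fg fg]]; first by exists f.
have [h Fh gh] := pF g Fg i; exists h => // u Uu.
by rewrite -gh//=; exact: partial_near_eq fg.
Qed.

Lemma partialD i f g u : differentiable f u -> differentiable g u ->
  partial i (fun v => f v + g v) u = partial i f u + partial i g u.
Proof. by move=> df dg; apply: deriveD; exact: diff_derivable. Qed.

Lemma partialM i f g u : differentiable f u -> differentiable g u ->
  partial i (fun v => f v * g v) u = f u * partial i g u + g u * partial i f u.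
Proof. by move=> df dg; apply: deriveM; exact: diff_derivable. Qed.

Lemma partialV i f u : differentiable f u -> f u != 0 ->
  partial i (fun v => (f v)^-1) u = - (f u * f u)^-1 * partial i f u.
Proof. by move=> df fu; rewrite -expr2; apply: deriveV => //; exact: diff_derivable. Qed.

Lemma partial_cst (i : 'I_n) c u : partial i (fun=> c) u = 0 :> R.
Proof. exact: derive_cst. Qed.

Lemma partial_coord (i j : 'I_n) u : partial i (fun v => v 0 j) u = (i == j)%:R :> R.
Proof.
have := derive_mx (@derivable_id R 'rV[R]_n u (delta_mx 0 i)).
by rewrite derive_id => /rowP/(_ j); rewrite !mxE eqxx /= eq_sym.
Qed.

(** All smooth functions are generators, so the sum, product and inverse rules express derivatives
    within the same family; this makes it a candidate for [smooth_coinduction] and avoids a Leibniz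
    formula for iterated derivatives. *)
Inductive smooth_closure U : ('rV[R]_n -> R) -> Prop :=
| SmoothBase f of smooth_on U f : smooth_closure U f
| SmoothCst c : smooth_closure U (fun=> c)
| SmoothCoord i : smooth_closure U (fun u => u 0 i)
| SmoothAdd f g of smooth_closure U f & smooth_closure U g :
    smooth_closure U (fun u => f u + g u)
| SmoothMul f g of smooth_closure U f & smooth_closure U g :
    smooth_closure U (fun u => f u * g u)
| SmoothInv f of smooth_closure U f & (forall u, U u -> f u != 0) :
    smooth_closure U (fun u => (f u)^-1).

Lemma smooth_closure_differentiable U f : smooth_closure U f ->
  forall u, U u -> differentiable f u.
Proof.
elim=> {f} [f sf|c|i|f g _ df _ dg|f g _ df _ dg|f _ df f0] u Uu.
- exact: smooth_differentiable sf Uu.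
- exact: differentiable_cst.
- exact: differentiable_coord.
- by apply: differentiableD; [exact: df|exact: dg].
- by apply: differentiableM; [exact: df|exact: dg].
- by apply: differentiableV; [exact: df|exact: f0].
Qed.

Lemma smooth_closure_partial U f : smooth_closure U f -> forall i,
  exists2 g, smooth_closure U g & forall u, U u -> partial i f u = g u.
Proof.
elim=> {f} [f sf|c|j|f g cf df cg dg|f g cf df cg dg|f cf df f0] i.
- by exists (partial i f) => //; apply/SmoothBase/smooth_partial.
- exists (fun=> 0); first exact: SmoothCst.
  by move=> u _; rewrite partial_cst.
- exists (fun=> (i == j)%:R); first exact: SmoothCst.
  by move=> u _; rewrite partial_coord.
- have [f' cf' ff'] := df i; have [g' cg' gg'] := dg i.
  exists (fun u => f' u + g' u); first exact: SmoothAdd.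
  move=> u Uu; rewrite partialD ?ff' ?gg'//.
    exact: smooth_closure_differentiable cf _ Uu.
  exact: smooth_closure_differentiable cg _ Uu.
- have [f' cf' ff'] := df i; have [g' cg' gg'] := dg i.
  exists (fun u => f u * g' u + g u * f' u).
    by apply: SmoothAdd; exact: SmoothMul.
  move=> u Uu; rewrite partialM ?ff' ?gg'//.
    exact: smooth_closure_differentiable cf _ Uu.
  exact: smooth_closure_differentiable cg _ Uu.
- have [f' cf' ff'] := df i.
  exists (fun u => (-1) * (f u * f u)^-1 * f' u).
    apply: SmoothMul => //; apply: SmoothMul; first exact: SmoothCst.
    apply: SmoothInv; first exact: SmoothMul.
    by move=> u Uu; rewrite mulf_neq0 ?f0.
  move=> u Uu; rewrite partialV ?ff' ?f0 ?mulN1r//.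
  exact: smooth_closure_differentiable cf _ Uu.
Qed.

Lemma smooth_closureP U f : open U -> smooth_closure U f -> smooth_on U f.
Proof.
move=> oU; apply: (smooth_coinduction oU).
  exact: smooth_closure_differentiable.
exact: smooth_closure_partial.
Qed.

Lemma smooth_eq U f g : open U -> (forall u, U u -> f u = g u) ->
  smooth_on U f -> smooth_on U g.
Proof.
move=> oU fg sf.
pose F h := exists2 f', smooth_on U f' & forall u, U u -> f' u = h u.
apply: (@smooth_coinduction U F) => //; last by exists f.
  move=> h [f' sf' fh] u Uu.
  apply: near_eq_differentiable (smooth_differentiable sf' Uu).
  exact: filterS (open_nbhs_nbhs (conj oU Uu)).
move=> h [f' sf' fh] i; exists (partial i f').
  by exists (partial i f') => //; exact: smooth_partial.
by move=> u Uu; apply: partial_near_eq oU Uu _ => v Uv; rewrite fh.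
Qed.

Section Closed.
Context (U : set 'rV[R]_n) (oU : open U).

Lemma smooth_cst c : smooth_on U (fun=> c).
Proof. by apply: smooth_closureP => //; exact: SmoothCst. Qed.

Lemma smooth_coord i : smooth_on U (fun u => u 0 i).
Proof. by apply: smooth_closureP => //; exact: SmoothCoord. Qed.

Lemma smoothD f g : smooth_on U f -> smooth_on U g -> smooth_on U (fun u => f u + g u).
Proof.
by move=> sf sg; apply: smooth_closureP => //; apply: SmoothAdd; exact: SmoothBase.
Qed.

Lemma smoothM f g : smooth_on U f -> smooth_on U g -> smooth_on U (fun u => f u * g u).
Proof.
by move=> sf sg; apply: smooth_closureP => //; apply: SmoothMul; exact: SmoothBase.
Qed.

Lemma smoothN f : smooth_on U f -> smooth_on U (fun u => - f u).
Proof.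
move=> sf; have := smoothM (smooth_cst (-1)) sf.
by apply: smooth_eq => // u _; rewrite mulN1r.
Qed.

Lemma smoothV f : (forall u, U u -> f u != 0) -> smooth_on U f ->
  smooth_on U (fun u => (f u)^-1).
Proof.
by move=> f0 sf; apply: smooth_closureP => //; apply: SmoothInv => //; exact: SmoothBase.
Qed.

Lemma smooth_sum (I : Type) (r : seq I) (P : pred I) (F : I -> 'rV[R]_n -> R) :
  (forall i, P i -> smooth_on U (F i)) -> smooth_on U (fun u => \sum_(i <- r | P i) F i u).
Proof.
move=> sF; elim: r => [|a r IH].
  by apply: smooth_eq (smooth_cst 0) => // u _; rewrite big_nil.
have [Pa|Pa] := boolP (P a).
  by apply: smooth_eq (smoothD (sF a Pa) IH) => // u _; rewrite big_cons Pa.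
by apply: smooth_eq IH => // u _; rewrite big_cons (negbTE Pa).
Qed.

Lemma smooth_prod (I : Type) (r : seq I) (P : pred I) (F : I -> 'rV[R]_n -> R) :
  (forall i, P i -> smooth_on U (F i)) -> smooth_on U (fun u => \prod_(i <- r | P i) F i u).
Proof.
move=> sF; elim: r => [|a r IH].
  by apply: smooth_eq (smooth_cst 1) => // u _; rewrite big_nil.
have [Pa|Pa] := boolP (P a).
  by apply: smooth_eq (smoothM (sF a Pa) IH) => // u _; rewrite big_cons Pa.
by apply: smooth_eq IH => // u _; rewrite big_cons (negbTE Pa).
Qed.

Lemma smooth_mulmx p q r (F : 'rV[R]_n -> 'M[R]_(p, q)) (G : 'rV[R]_n -> 'M[R]_(q, r)) :
  smooth_mx_on U F -> smooth_mx_on U G -> smooth_mx_on U (fun u => F u *m G u).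
Proof.
move=> sF sG i j; apply: (@smooth_eq _ (fun u => \sum_k F u i k * G u k j)) => //.
  by move=> u _; rewrite mxE.
by apply: smooth_sum => k _; apply: smoothM; [exact: sF|exact: sG].
Qed.

Lemma smooth_det p (F : 'rV[R]_n -> 'M[R]_p) :
  smooth_mx_on U F -> smooth_on U (fun u => \det (F u)).
Proof.
move=> sF; rewrite /determinant; apply: smooth_sum => s _.
by apply: smoothM; [exact: smooth_cst|apply: smooth_prod => i _; exact: sF].
Qed.

Lemma smooth_invmx p (F : 'rV[R]_n -> 'M[R]_p) : (forall u, U u -> F u \in unitmx) ->
  smooth_mx_on U F -> smooth_mx_on U (fun u => invmx (F u)).
Proof.
move=> uF sF i j.
(* By Cramer's rule the entries of the inverse are rational in those of [F], with nonvanishing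
   denominator. *)
apply: (@smooth_eq _ (fun u => (\det (F u))^-1 * cofactor (F u) j i)) => //.
  by move=> u Uu; rewrite /invmx uF// !mxE.
apply: smoothM.
  by apply: smoothV; [move=> u Uu; have := uF u Uu; rewrite unitmxE unitfE|exact: smooth_det].
apply: smoothM; first exact: smooth_cst.
apply: smooth_det => k l.
by apply: smooth_eq (sF (lift j k) (lift i l)) => // u _; rewrite !mxE.
Qed.

End Closed.
End Smooth.

(** * 1-jets of matrix-valued fields *)

Section MxC.
Context {R : realType}.

Lemma mxCM m n p (A : 'M[R]_(m, n)) (B : 'M[R]_(n, p)) : mxC (A *m B) = mxC A *m mxC B.
Proof. exact: (map_mxM (real_complex R)). Qed.

Lemma mxCD m n (A B : 'M[R]_(m, n)) : mxC (A + B) = mxC A + mxC B.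
Proof. exact: (map_mxD (real_complex R)). Qed.

Lemma mxCN m n (A : 'M[R]_(m, n)) : mxC (- A) = - mxC A.
Proof. exact: (map_mxN (real_complex R)). Qed.

Lemma mxCZ m n a (A : 'M[R]_(m, n)) : mxC (a *: A) = a%:C *: mxC A.
Proof. exact: (map_mxZ (real_complex R)). Qed.

Lemma mxC_tr m n (A : 'M[R]_(m, n)) : mxC A^T = (mxC A)^T.
Proof. by rewrite /mxC map_trmx. Qed.

Lemma mxC1 n : mxC 1%:M = 1%:M :> 'M[R[i]]_n.
Proof. exact: (map_mx1 (real_complex R)). Qed.

Lemma mxC0 m n : mxC 0 = 0 :> 'M[R[i]]_(m, n).
Proof. exact: (map_mx0 (real_complex R)). Qed.

Lemma mxC_row m n i (A : 'M[R]_(m, n)) : mxC (row i A) = row i (mxC A).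
Proof. exact: map_row. Qed.

End MxC.

Lemma differentiable_mx (R : realType) n m (F : 'rV[R]_n -> 'rV[R]_m) u :
  (forall j, differentiable (fun v => F v 0 j) u) -> differentiable F u.
Proof.
move=> dF.
have -> : F = \sum_j (fun v => F v 0 j *: delta_mx 0 j).
  by apply/funext => v; rewrite fct_sumE [LHS]row_sum_delta.
by apply: differentiable_sum => j; exact: differentiableZl.
Qed.

Section MxPartial.
Context {R : realType} {n : nat}.

Definition pmx p q (l : 'I_n) (F : 'rV[R]_n -> 'M[R]_(p, q)) u : 'M[R]_(p, q) :=
  \matrix_(i, j) partial l (fun v => F v i j) u.

Lemma partial_sum (I : finType) l (f : I -> 'rV[R]_n -> R) u :
  (forall k, differentiable (f k) u) ->
  partial l (fun v => \sum_k f k v) u = \sum_k partial l (f k) u.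
Proof.
move=> df; elim: (index_enum I) => [|k r IH].
  rewrite big_nil -[RHS](partial_cst l 0 u); congr (partial l _ u).
  by apply/funext => v; rewrite big_nil.
rewrite big_cons -IH -partialD//.
  by congr (partial l _ u); apply/funext => v; rewrite big_cons.
elim: {IH} r => [|a r IH].
  rewrite (_ : (fun _ => _) = cst 0); first exact: differentiable_cst.
  by apply/funext => v; rewrite big_nil.
rewrite (_ : (fun _ => _) = f a + (fun v => \sum_(i <- r) f i v)).
  exact: differentiableD.
by apply/funext => v; rewrite big_cons.
Qed.

Section At.
Context (u : 'rV[R]_n) (l : 'I_n).

Lemma pmxM p q r (F : 'rV[R]_n -> 'M[R]_(p, q)) (G : 'rV[R]_n -> 'M[R]_(q, r)) :
  (forall i j, differentiable (fun v => F v i j) u) ->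
  (forall i j, differentiable (fun v => G v i j) u) ->
  pmx l (fun v => F v *m G v) u = pmx l F u *m G u + F u *m pmx l G u.
Proof.
move=> dF dG; apply/matrixP => i j; rewrite !mxE -big_split /=.
transitivity (partial l (fun v => \sum_k F v i k * G v k j) u).
  by congr (partial l _ u); apply/funext => v; rewrite mxE.
rewrite partial_sum => [|k]; last exact: differentiableM.
by apply: eq_bigr => k _; rewrite partialM// 2!mxE; ring.
Qed.

Lemma pmxT p q (F : 'rV[R]_n -> 'M[R]_(p, q)) : pmx l (fun v => (F v)^T) u = (pmx l F u)^T.
Proof.
apply/matrixP => i j; rewrite !mxE; congr (partial l _ u).
by apply/funext => v; rewrite mxE.
Qed.

Lemma pmxN p q (F : 'rV[R]_n -> 'M[R]_(p, q)) :
  (forall i j, differentiable (fun v => F v i j) u) ->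
  pmx l (fun v => - F v) u = - pmx l F u.
Proof.
move=> dF; apply/matrixP => i j; rewrite !mxE /partial -deriveN; last exact: diff_derivable.
rewrite (_ : (fun v => (- F v) i j) = - (fun v => F v i j))//.
by apply/funext => v; rewrite mxE.
Qed.

Lemma pmx_cst p q (F : 'M[R]_(p, q)) : pmx l (fun=> F) u = 0.
Proof. by apply/matrixP => i j; rewrite !mxE partial_cst. Qed.

Lemma pmx_eq U p q (F G : 'rV[R]_n -> 'M[R]_(p, q)) : open U -> U u ->
  (forall v, U v -> F v = G v) -> pmx l F u = pmx l G u.
Proof.
move=> oU Uu FG; apply/matrixP => i j; rewrite !mxE.
by apply: (partial_near_eq _ oU) => // v Uv; rewrite FG.
Qed.

End At.

Lemma derive_rowE m (F : 'rV[R]_n -> 'rV[R]_m) (w u : 'rV[R]_n) :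
  (forall j, differentiable (fun v => F v 0 j) u) ->
  'D_w F u = \sum_l w 0 l *: pmx l F u.
Proof.
move=> dF; have dF' := differentiable_mx dF.
rewrite deriveE// {1}[w]row_sum_delta linear_sum; apply: eq_bigr => l _.
rewrite linearZ -deriveE//= derive_mx; last exact: diff_derivable.
by [].
Qed.

Lemma jacobianE m (F : 'rV[R]_n -> 'rV[R]_m) u i j : differentiable F u ->
  ('J F u) i j = partial i (fun v => F v 0 j) u.
Proof.
move=> dF; have := deriveEjacobian (delta_mx 0 i) dF.
rewrite -rowE derive_mx; last exact: diff_derivable.
by move=> /rowP/(_ j); rewrite !mxE.
Qed.

(** The Nijenhuis tensor is evaluated on constant coordinate fields: their own derivatives vanish,
    so only first derivatives of [A] at [u] remain. *)
Lemma integrable_jetP U (A : 'rV[R]_n -> 'M[R]_n) u : open U -> U u ->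
  smooth_mx_on U A ->
  (forall X Y, smooth_mx_on U X -> smooth_mx_on U Y -> nijenhuis A X Y u = 0) ->
  integrable_jet (mxC (A u)) (fun l => mxC (pmx l A u)).
Proof.
move=> oU Uu sA nij a b.
have rA c l : pmx l (fun v => row c (A v)) u = row c (pmx l A u).
  apply/matrixP => i j; rewrite !mxE; congr (partial l _ u).
  by apply/funext => v; rewrite mxE.
have DA w c : 'D_w (fun v => row c (A v)) u = \sum_l w 0 l *: row c (pmx l A u).
  rewrite derive_rowE => [|j].
    by apply: eq_bigr => l _; rewrite rA.
  rewrite (_ : (fun _ => _) = fun v => A v c j); first exact: smooth_differentiable (sA c j) Uu.
  by apply/funext => v; rewrite mxE.
have Dd c d : 'D_(delta_mx 0 d) (fun v => row c (A v)) u = row c (pmx d A u).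
  rewrite DA (bigD1 d)//= big1 ?addr0 => [|l ld]; rewrite mxE ?eqxx ?scale1r//.
  by rewrite (negbTE ld) scale0r.
have sc (c : 'I_n) : smooth_mx_on U (fun=> delta_mx 0 c : 'rV[R]_n).
  by move=> i j; exact: smooth_cst.
have rE c : (fun v => delta_mx 0 c *m A v) = fun v => row c (A v).
  by apply/funext => v; rewrite -rowE.
have /= := nij _ _ (sc a) (sc b).
rewrite /nijenhuis /lie_bracket !rE !derive_cst !Dd !DA subr0 subrr sub0r subr0 => E.
have {}E : row b (contr (A u) (fun l => pmx l A u) a) - row a (contr (A u) (fun l => pmx l A u) b)
    = row b (pmx a A u *m A u) - row a (pmx b A u *m A u).
  have S c d : \sum_l ((delta_mx 0 c : 'rV[R]_n) *m A u) 0 l *: row d (pmx l A u) =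
      row d (contr (A u) (fun l => pmx l A u) c).
    have /= -> := congr1 (fun f => f u) (rE c).
    by rewrite /contr row_sumE; apply: eq_bigr => l _; rewrite mxE linearZ.
  move: E; rewrite !S !row_mul mulNmx opprK => /eqP.

  by rewrite subr_eq add0r -[X in _ + X]opprK subr_eq => /eqP.
have := congr1 (@mxC R _ _) E.
rewrite !(mxCD, mxCN, mxC_row, mxCM).
have mxC_contr c : mxC (contr (A u) (fun l => pmx l A u) c) =
    contr (mxC (A u)) (fun l => mxC (pmx l A u)) c.
  apply/matrixP => p q; rewrite mxE !contrE (rmorph_sum (real_complex R)).
  by apply: eq_bigr => l _; rewrite !mxE (rmorphM (real_complex R)).
by rewrite !mxC_contr.
Qed.

End MxPartial.

(** * The operator d^c on forms of type (1,1) *)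

Lemma big_bool2 (V : nmodType) (F : bool * bool -> V) :
  \sum_e F e = (F (true, true) + F (true, false)) + (F (false, true) + F (false, false)).
Proof.
rewrite (eq_bigr (fun e => F (e.1, e.2))) => [|[]//].
by rewrite -(pair_bigA _ (fun a b => F (a, b))) /= !big_bool.
Qed.

Lemma big_bool3 (V : nmodType) (F : bool * bool * bool -> V) :
  \sum_e F e = \sum_e (F (e, true) + F (e, false)).
Proof.
rewrite (eq_bigr (fun e => F (e.1, e.2))) => [|[]//].
rewrite -(pair_bigA _ (fun a b => F (a, b))) /=.
by apply: eq_bigr => e _; rewrite big_bool.
Qed.

Lemma big_bool2_1 (V : nmodType) (F : bool * bool -> V) :
  \sum_(e : bool * bool | (e.1 + e.2)%N == 1) F e = F (true, false) + F (false, true).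
Proof. by rewrite big_mkcond big_bool2 /= add0r addr0. Qed.

Lemma big_bool3_1 (V : nmodType) (F : bool * bool * bool -> V) :
  \sum_(e : bool * bool * bool | (e.1.1 + e.1.2 + e.2)%N == 1) F e =
  F (false, false, true) + F (false, true, false) + F (true, false, false).
Proof.
rewrite big_mkcond big_bool3 big_bool2 /= !(addr0, add0r).
by rewrite [RHS]addrC [_ + F (false, true, false)]addrC.
Qed.

Lemma big_bool3_2 (V : nmodType) (F : bool * bool * bool -> V) :
  \sum_(e : bool * bool * bool | (e.1.1 + e.1.2 + e.2)%N == 2) F e =
  F (true, true, false) + F (true, false, true) + F (false, true, true).
Proof. by rewrite big_mkcond big_bool3 big_bool2 /= !(addr0, add0r). Qed.

Section Types.
Context {R : realType} {n : nat}.
Implicit Types (A : 'M[R]_n) (W : 'M[R[i]]_n).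

Lemma mulii : 'i * 'i = -1 :> R[i].
Proof. by rewrite -expr2 sqrCi. Qed.

Lemma type_projD A : type_proj A true + type_proj A false = 1%:M.
Proof.
rewrite /type_proj -scalerDr addrACA addNr addr0; apply/matrixP => i j.
by rewrite !mxE; field.
Qed.

(** On two vectors from one eigenspace, invariance under [A] multiplies the value by the square of
    the eigenvalue, which is -1. *)
Lemma type_proj_sandwich A W b : mxC A *m W *m (mxC A)^T = W ->
  mxC A *m W = - (W *m (mxC A)^T) -> type_proj A b *m W *m (type_proj A b)^T = 0.
Proof.
move=> AWA AW; rewrite /type_proj.
have E (c : R[i]) : c * c = -1 -> (2%:R^-1 *: (1%:M + c *: mxC A)) *m W *m
    (2%:R^-1 *: (1%:M + c *: mxC A))^T = 0.
  move=> c2.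
  have -> : (2%:R^-1 *: (1%:M + c *: mxC A))^T = 2%:R^-1 *: (1%:M + c *: (mxC A)^T).
    by rewrite linearZ; congr (_ *: _); rewrite linearD /= trmx1 linearZ.
  rewrite -!scalemxAl -scalemxAr !mulmxDl mul1mx !mulmxDr !mulmx1.
  rewrite -!scalemxAl -!scalemxAr AWA scalerA c2.
  by rewrite AW scalerN scaleN1r addrA addrK subrr !scaler0.
case: b; last exact/E/mulii.
by rewrite -scaleNr; apply: E; rewrite mulrNN mulii.
Qed.

Lemma form2_part1 A W : mxC A *m W *m (mxC A)^T = W ->
  mxC A *m W = - (W *m (mxC A)^T) -> form2_part A 1 W = W.
Proof.
move=> AWA AW; rewrite /form2_part big_bool2_1.
have := type_projD A; have := fun b => type_proj_sandwich b AWA AW.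
move: (type_proj A) => T /[dup] /(_ true) tt0 /(_ false) ff0 tf.
have E : (T true + T false) *m W *m (T true + T false)^T = W.
  by rewrite tf trmx1 mulmx1 mul1mx.
rewrite -[RHS]E linearD /= !mulmxDl !mulmxDr.
by rewrite tt0 ff0 add0r addr0 addrC.
Qed.

Lemma form2_part_neq1 A W p : p != 1 -> mxC A *m W *m (mxC A)^T = W ->
  mxC A *m W = - (W *m (mxC A)^T) -> form2_part A p W = 0.
Proof.
move=> p1 AWA AW; rewrite /form2_part big1// => -[a b] /= e.
have -> : b = a by move: e p1; case: a b => [] [] //= /eqP <-.
exact: type_proj_sandwich.
Qed.

Lemma form3_part1 A tau i j k :
  let t := type_proj A true in let f := type_proj A false in
  form3_part A 1 tau i j k =
  act3 f f t tau i j k + act3 f t f tau i j k + act3 t f f tau i j k.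
Proof.
exact: (big_bool3_1 (fun e => act3 (type_proj A e.1.1) (type_proj A e.1.2)
  (type_proj A e.2) tau i j k)).
Qed.

Lemma form3_part2 A tau i j k :
  let t := type_proj A true in let f := type_proj A false in
  form3_part A 2 tau i j k =
  act3 t t f tau i j k + act3 t f t tau i j k + act3 f t t tau i j k.
Proof.
exact: (big_bool3_2 (fun e => act3 (type_proj A e.1.1) (type_proj A e.1.2)
  (type_proj A e.2) tau i j k)).
Qed.

Lemma form3_part0 A p i j k : form3_part A p (fun _ _ _ => 0) i j k = 0.
Proof.
rewrite /form3_part big1// => e _; rewrite big1// => a _; rewrite big1// => b _.
by rewrite big1// => c _; rewrite mulr0.
Qed.

End Types.

Section LocalForms.
Context {R : realType} {n : nat} (U : set 'rV[R]_n) (oU : open U) (u : 'rV[R]_n) (Uu : U u).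

Lemma cpartial_mxC l p q (w : 'rV[R]_n -> 'M[R]_(p, q)) j k :
  cpartial l (fun v => mxC (w v) j k) u = mxC (pmx l w u) j k.
Proof.
rewrite /cpartial !mxE.
have -> : (fun v => complex.Re (mxC (w v) j k)) = (fun v => w v j k).
  by apply/funext => v; rewrite mxE.
have -> : (fun v => complex.Im (mxC (w v) j k)) = (fun=> 0).
  by apply/funext => v; rewrite mxE.
by rewrite partial_cst.
Qed.

Lemma cpartial_near_eq l (f g : 'rV[R]_n -> R[i]) : (forall v, U v -> f v = g v) ->
  cpartial l f u = cpartial l g u.
Proof.
move=> fg; rewrite /cpartial.
by congr (_ +i* _); apply: (partial_near_eq _ oU) => // v Uv; rewrite fg.
Qed.

Lemma ext_d2_mxC (al : 'rV[R]_n -> 'M[R[i]]_n) (w : 'rV[R]_n -> 'M[R]_n) :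
  (forall v, U v -> al v = mxC (w v)) ->
  ext_d2 al u = dform (fun l => mxC (pmx l w u)).
Proof.
move=> alw.
have E l a b : cpartial l (fun v => al v a b) u = mxC (pmx l w u) a b.
  by rewrite -cpartial_mxC; apply: cpartial_near_eq => v Uv; rewrite alw.
by apply/funext => i; apply/funext => j; apply/funext => k; rewrite /ext_d2 !E.
Qed.

Section Dc.
Context (A w : 'rV[R]_n -> 'M[R]_n).
Hypotheses (sA : smooth_mx_on U A) (sw : smooth_mx_on U w).
Hypothesis A2 : forall v, U v -> A v *m A v = - 1%:M.
Hypothesis nA : integrable_jet (mxC (A u)) (fun l => mxC (pmx l A u)).
Hypothesis AwA : forall v, U v -> A v *m w v *m (A v)^T = w v.
Hypothesis wT : forall v, U v -> (w v)^T = - w v.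

Lemma hermitian_skewC v : U v -> A v *m w v = - (w v *m (A v)^T).
Proof.
move=> Uv; rewrite -[in RHS]AwA// -!mulmxA -trmx_mul A2// linearN /= trmx1.
by rewrite !mulmxN mulmx1 opprK.
Qed.

Let dfA i j : differentiable (fun v => A v i j) u.
Proof. exact: smooth_differentiable (sA i j) Uu. Qed.

Let dfw i j : differentiable (fun v => w v i j) u.
Proof. exact: smooth_differentiable (sw i j) Uu. Qed.

Lemma complex_structure_jet l :
  mxC (pmx l A u) *m mxC (A u) + mxC (A u) *m mxC (pmx l A u) = 0.
Proof.
rewrite -!mxCM -mxCD -pmxM// (pmx_eq _ oU Uu A2) pmx_cst; exact: mxC0.
Qed.

Lemma dcE i j k : dc A (fun v => mxC (w v)) u i j k =
  - act3 (mxC (A u)) (mxC (A u)) (mxC (A u)) (dform (fun l => mxC (pmx l w u))) i j k.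
Proof.
have AwAC v : U v -> mxC (A v) *m mxC (w v) *m (mxC (A v))^T = mxC (w v).
  by move=> Uv; rewrite -mxC_tr -!mxCM AwA.
have AwC v : U v -> mxC (A v) *m mxC (w v) = - (mxC (w v) *m (mxC (A v))^T).
  by move=> Uv; rewrite -mxC_tr -!mxCM hermitian_skewC// mxCN.
have d1 : ext_d2 (fun v => form2_part (A v) 1 (mxC (w v))) u =
    dform (fun l => mxC (pmx l w u)).
  by apply: ext_d2_mxC => v Uv; rewrite form2_part1// ?AwAC ?AwC.
have d0 p : p != 1 -> ext_d2 (fun v => form2_part (A v) p (mxC (w v))) u = fun _ _ _ => 0.
  move=> p1; rewrite (@ext_d2_mxC _ (fun=> 0)) => [|v Uv].
    apply/funext => a; apply/funext => b; apply/funext => c.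
    by rewrite /dform !pmx_cst !mxE subrr addr0.
  by rewrite form2_part_neq1 ?mxC0// ?AwAC ?AwC.
(* Since [w] is of type (1,1), only the summand of degree 1 survives: [delbar] keeps the (1,2) part
   of the exterior derivative and [del] the (2,1) part. *)
rewrite /dc /del /delbar !big_ord_recl !big_ord0 /= d1 !d0// !form3_part0 !addr0 !add0r.
rewrite form3_part1 form3_part2.
have A2C : mxC (A u) *m mxC (A u) = - 1%:M by rewrite -mxCM A2// mxCN mxC1.
have dAw l : mxC (pmx l A u) *m mxC (w u) + mxC (A u) *m mxC (pmx l w u) =
  - (mxC (pmx l w u) *m (mxC (A u))^T + mxC (w u) *m (mxC (pmx l A u))^T).
  have dwA : forall i0 j0, differentiable (fun v => (w v *m (A v)^T) i0 j0) u.
    move=> a b; apply: (smooth_differentiable _ Uu).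
    by apply: smooth_mulmx => // c d; apply: smooth_eq (sA d c) => // v _; rewrite mxE.
  rewrite -!mxC_tr -!mxCM -!mxCD -mxCN; congr mxC.
  rewrite -pmxT -!pmxM//; last by move=> c d; under eq_fun do rewrite mxE.
  rewrite -pmxN//; exact: (pmx_eq _ oU Uu hermitian_skewC).
have wTC : (mxC (w u))^T = - mxC (w u) by rewrite -mxC_tr wT// mxCN.
exact: (dc_jet A2C complex_structure_jet nA (AwC _ Uu) dAw wTC i j k mulii).
Qed.

End Dc.
End LocalForms.

(** * Schouten brackets of the dual bivectors *)

Section DualBivectors.
Context {R : realType} {n : nat} (U : set 'rV[R]_n) (oU : open U).
Context (G : 'rV[R]_n -> 'M[R]_n).
Hypotheses (sG : smooth_mx_on U G) (uG : forall v, U v -> G v \in unitmx).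
Hypothesis GT : forall v, U v -> (G v)^T = G v.
Implicit Types (A B : 'rV[R]_n -> 'M[R]_n).

Definition hermitian_structure A := [/\ smooth_mx_on U A,
  forall v, U v -> A v *m A v = - 1%:M,
  forall X Y, smooth_mx_on U X -> smooth_mx_on U Y ->
    forall v, U v -> nijenhuis A X Y v = 0
  & forall v, U v -> A v *m G v *m (A v)^T = G v].

Definition dual_field A v := invmx (A v *m G v).

Section One.
Context (A : 'rV[R]_n -> 'M[R]_n) (hA : hermitian_structure A).

Lemma hermitian_skew v : U v -> A v *m G v = - (G v *m (A v)^T).
Proof.
case: hA => sA A2 _ AGA Uv.
rewrite -[in RHS]AGA// -!mulmxA -trmx_mul A2// linearN /= trmx1.
by rewrite !mulmxN mulmx1 opprK.
Qed.

Lemma complex_structure_unit v : U v -> A v \in unitmx.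
Proof.
case: hA => sA A2 _ AGA Uv; have /mulmx1_unit[] // : A v *m (- A v) = 1%:M.
by rewrite mulmxN A2// opprK.
Qed.

(** The factor [invmx (G v)] is the same for [I], [J] and [K], so the quaternion relations pass to
    the dual bivectors by right multiplication. *)
Lemma dualE v : U v -> dual_field A v = - (invmx (G v) *m A v).
Proof.
move=> Uv; case: hA => sA A2 _ AGA; rewrite /dual_field.
have AGu : A v *m G v \in unitmx by rewrite unitmx_mul complex_structure_unit// uG.
apply: (can_inj (mulKmx AGu)); rewrite mulmxV// mulmxN -mulmxA.
by rewrite (mulKVmx (uG Uv)) A2// opprK.
Qed.

Lemma dualK v : U v -> A v *m G v *m dual_field A v = 1%:M.
Proof. by move=> Uv; rewrite mulmxV// unitmx_mul complex_structure_unit// uG. Qed.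

Lemma dual_skew v : U v -> (dual_field A v)^T = - dual_field A v.
Proof.
move=> Uv; rewrite /dual_field trmx_inv trmx_mul GT//.
have AGu : A v *m G v \in unitmx by rewrite unitmx_mul complex_structure_unit// uG.
apply: (can_inj (mulKmx AGu)); rewrite mulmxN mulmxV//.
rewrite hermitian_skew// mulNmx mulmxV//.
have := AGu; rewrite hermitian_skew// -scaleN1r unitmxZ//.
by rewrite unitrN1.
Qed.

Lemma smooth_dual : smooth_mx_on U (dual_field A).
Proof.
case: hA => sA A2 _ AGA; apply: smooth_invmx => //.
  by move=> v Uv; rewrite unitmx_mul complex_structure_unit// uG.
exact: smooth_mulmx.
Qed.

End One.

Section At.
Context (u : 'rV[R]_n) (Uu : U u).

Definition dual_jet A l := mxC (pmx l (dual_field A) u).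
Definition dual_bracket A B := sch_jet (mxC (dual_field A u)) (mxC (dual_field B u)) (dual_jet A) (dual_jet B).
Definition dc_form A := dc A (fun v => mxC (A v *m G v)) u.

Lemma dual_jetT A l : hermitian_structure A -> (dual_jet A l)^T = - dual_jet A l.
Proof.
move=> hA; rewrite -mxC_tr -mxCN -pmxT -pmxN; last first.
  by move=> i j; exact: smooth_differentiable (smooth_dual hA i j) Uu.
by congr mxC; apply: (pmx_eq _ oU) => // v Uv; exact: dual_skew.
Qed.

Lemma act3_N1 (X : 'M[R[i]]_n) t i j k : act3 (- X) (- X) (- X) t i j k = - act3 X X X t i j k.
Proof. by rewrite -scaleN1r act3ZX act3ZY act3ZZ; ring. Qed.

(** Raising indices by [- invmx (G u) *m A u] first rotates by [A] and then raises by the inverse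
    metric. The sign of the three factors cancels the sign in [dcE]. *)
Lemma dual_bracketE A i j k : hermitian_structure A ->
  dual_bracket A A i j k = 2%:R * act3 (mxC (invmx (G u))) (mxC (invmx (G u)))
    (mxC (invmx (G u))) (dc_form A) i j k.
Proof.
move=> hA; case: (hA) => sA A2 nA AGA.
have sAG : smooth_mx_on U (fun v => A v *m G v) by exact: smooth_mulmx.
rewrite /dual_bracket (@sch_jet_dual _ _ _ (mxC (A u *m G u)) _
  (fun l => mxC (pmx l (fun v => A v *m G v) u))).
- congr (_ * _).
  have PE : mxC (dual_field A u) = - (mxC (invmx (G u)) *m mxC (A u)).
    by rewrite dualE// mxCN mxCM.
  rewrite PE act3_N1 -act3_comp -act3N; apply: eq_act3 => a b c.
  rewrite /dc_form (dcE oU) //.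
  + apply: (integrable_jetP oU) => // X Y sX sY; exact: nA.
  + by move=> v Uv; rewrite -(mulmxA (A v)) AGA.
  + by move=> v Uv; rewrite trmx_mul GT// hermitian_skew// opprK.
- by rewrite -mxC_tr dual_skew// mxCN.
- by move=> l; exact: dual_jetT.
- by rewrite -mxCM dualK// mxC1.
- move=> l; rewrite -!mxCM -mxCD -pmxM.
  + rewrite (pmx_eq (G := fun=> 1%:M) _ oU Uu) ?pmx_cst ?mxC0//.
    by move=> v Uv; rewrite dualK.
  + by move=> a b; exact: smooth_differentiable (sAG a b) Uu.
  + by move=> a b; exact: smooth_differentiable (smooth_dual hA a b) Uu.
Qed.

(** Both brackets are twice a [d^c] form with indices raised by the same metric, and lowering the
    indices with [G] undoes this. *)
Lemma dual_bracket_eq A B : hermitian_structure A -> hermitian_structure B ->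
  (forall i j k, dc_form A i j k = dc_form B i j k) <->
  (forall i j k, dual_bracket A A i j k = dual_bracket B B i j k).
Proof.
move=> hA hB; split=> [AB i j k|AB i j k].
  apply: etrans (dual_bracketE i j k hA) (etrans _ (esym (dual_bracketE i j k hB))).
  exact: (congr1 (fun x => 2%:R * x) (eq_act3 _ _ _ _ _ _ AB)).
set g := mxC (G u); set h := mxC (invmx (G u)).
have gh : g *m h = 1%:M by rewrite -mxCM mulmxV ?uG// mxC1.
have ghE t : act3 g g g (act3 h h h t) i j k = t i j k.
  by rewrite act3_comp gh act3_1.
apply: etrans (esym (ghE _)) (etrans _ (ghE _)); apply: eq_act3 => a b c.
have two : 2%:R != 0 :> R[i] by rewrite pnatr_eq0.
apply: (mulfI two).
exact: etrans (esym (dual_bracketE a b c hA)) (etrans (AB a b c) (dual_bracketE a b c hB)).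
Qed.

(** Multiplying on the right by [A] turns the dual bivector of [B] into that of [C], which is the
    situation of [sch_jet_mixed]. The roles are kept abstract so that [I], [J], [K] can be permuted
    cyclically. *)
Lemma dual_bracket_mixed A B C : hermitian_structure A -> hermitian_structure B ->
  hermitian_structure C -> (forall v, U v -> B v *m A v = C v) ->
  (forall i j k, dual_bracket B B i j k = dual_bracket C C i j k) ->
  forall i j k, dual_bracket B C i j k = 0.
Proof.
move=> hA hB hC BA.
have BA' v : U v -> dual_field B v *m A v = dual_field C v.
  by move=> Uv; rewrite !dualE// mulNmx -mulmxA BA.
case: (hA) => sA A2 nA AGA.
apply: (@sch_jet_mixed _ _ 'i (mxC (A u)) _ _ (fun l => mxC (pmx l A u))); first exact: mulii.
- by move=> l; apply: (complex_structure_jet oU Uu).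
- apply: (integrable_jetP oU) => // X Y sX sY; exact: nA.
- by rewrite -mxC_tr dual_skew// mxCN.
- by move=> l; exact: dual_jetT.
- by rewrite -mxC_tr dual_skew// mxCN.
- by move=> l; exact: dual_jetT.
- by rewrite -mxCM BA'.
- move=> l; rewrite -!mxCM -mxCD -pmxM.
  + by congr mxC; exact: (pmx_eq _ oU).
  + by move=> a b; exact: smooth_differentiable (smooth_dual hB a b) Uu.
  + by move=> a b; exact: smooth_differentiable (sA a b) Uu.
- by rewrite -mxCM A2// mxCN mxC1.
Qed.

(** The coefficients are constant on the slice, so they come out of the derivatives; real and
    imaginary parts are separated because [cpartial] is defined through them. *)
Lemma schouten_comb (q : 'I_3 -> R[i]) (F : 'I_3 -> 'rV[R]_n -> 'M[R]_n) i j k :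
  (forall s, smooth_mx_on U (F s)) ->
  let Q v := \sum_s q s *: mxC (F s v) in
  schouten Q Q u i j k = \sum_s \sum_t q s * q t *
    sch_jet (mxC (F s u)) (mxC (F t u)) (fun l => mxC (pmx l (F s) u))
      (fun l => mxC (pmx l (F t) u)) i j k.
Proof.
move=> sF Q.
have dF s a b : differentiable (fun v => F s v a b) u.
  exact: smooth_differentiable (sF s a b) Uu.
have dQ l a b : cpartial l (fun v => Q v a b) u = \sum_s q s * mxC (pmx l (F s) u) a b.
  have comb (c : 'I_3 -> R) : partial l (fun v => \sum_s c s * F s v a b) u =
      \sum_s c s * partial l (fun v => F s v a b) u.
    rewrite partial_sum => [|s]; last exact: differentiableM.
    by apply: eq_bigr => s _; rewrite partialM// partial_cst mulr0 addr0.
  have ReE v : complex.Re (Q v a b) = \sum_s complex.Re (q s) * F s v a b.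
    rewrite summxE (raddf_sum (@complex.Re R)); apply: eq_bigr => s _.
    by rewrite !mxE; case: (q s) => x y /=; rewrite mulr0 subr0.
  have ImE v : complex.Im (Q v a b) = \sum_s complex.Im (q s) * F s v a b.
    rewrite summxE (raddf_sum (@complex.Im R)); apply: eq_bigr => s _.
    by rewrite !mxE; case: (q s) => x y /=; rewrite mulr0 add0r.
  rewrite /cpartial; under eq_fun do rewrite ReE.
  under [X in _ +i* partial l X u]eq_fun do rewrite ImE.
  rewrite !comb; apply/eqP; rewrite eq_complex /=.
  rewrite (raddf_sum (@complex.Re R)) (raddf_sum (@complex.Im R)) /=.
  apply/andP; split; apply/eqP; apply: eq_bigr => s _; rewrite !mxE;
    by case: (q s) => x y /=; rewrite mulr0 ?subr0 ?add0r.
have dQ' l a b : cpartial l (fun v => Q v a b) u = (\sum_s q s *: mxC (pmx l (F s) u)) a b.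
  by rewrite dQ summxE; apply: eq_bigr => s _; rewrite [RHS]mxE.
rewrite -(sch_jet_comb q (fun s => mxC (F s u)) (fun s l => mxC (pmx l (F s) u))).
rewrite /schouten /sch_jet.
by congr (_ + _ + _); apply: eq_bigr => l _; rewrite !dQ'.
Qed.

End At.
End DualBivectors.

(** * The (2,0) part of the dual bivector *)

Definition triple (T : Type) (x y z : T) (s : 'I_3) : T :=
  if s == 0 then x else if s == 1 then y else z.

Lemma sum3 (V : nmodType) (F : 'I_3 -> V) : \sum_s F s = F 0 + F 1 + F 2%:R.
Proof.
rewrite !big_ord_recl big_ord0 addr0 addrA.
by congr (_ + F _ + F _); apply/val_inj.
Qed.

(** The assumptions say that [S] is scalar, so the double sum is [S 0 0] times the sum of squares of
    [q]. *)
Lemma null_sum (C : comPzRingType) (q : 'I_3 -> C) (S : 'I_3 -> 'I_3 -> C) :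
  (forall s t, S s t = S t s) -> S 0 1 = 0 -> S 1 2%:R = 0 -> S 2%:R 0 = 0 ->
  S 1 1 = S 0 0 -> S 2%:R 2%:R = S 0 0 -> \sum_s q s * q s = 0 ->
  \sum_s \sum_t q s * q t * S s t = 0.
Proof.
move=> SC S01 S12 S20 S11 S22; rewrite !sum3 => q0.
rewrite (SC 1 0) (SC 0 2%:R) (SC 2%:R 1) S01 S12 S20 S11 S22.
by rewrite !mulr0 !addr0 !add0r -!mulrDl q0 mul0r.
Qed.

(** This is half of [v - iota w], where [v] is the part of the first basis vector [e_1] orthogonal
    to the unit vector [(a, b, c)] and [w] is the cross product of [(a, b, c)] with [e_1]. As [v]
    and [w] are orthogonal and of equal length, the result is a null vector. *)
Definition twistor_coef (C : numFieldType) (iota a b c : C) : 'I_3 -> C :=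
  triple (2%:R^-1 * (1 - a * a))
    (- 2%:R^-1 * (a * b + iota * c)) (- 2%:R^-1 * (a * c - iota * b)).

(** Passing to the antipode changes the sign of the part in [iota], so the equations at two
    antipodal points add up to a relation between diagonal entries. Integer points are enough, and
    for them the unit-length condition holds by computation. *)
Lemma twistor_sum_diag (C : numFieldType) (iota : C) (S : 'I_3 -> 'I_3 -> C) :
  iota * iota = -1 -> (forall s t, S s t = S t s) ->
  (forall a b c : int, a * a + b * b + c * c = 1 ->
    let q := twistor_coef iota a%:~R b%:~R c%:~R in
    \sum_s \sum_t q s * q t * S s t = 0) ->
  S 0 0 = S 1 1 /\ S 1 1 = S 2%:R 2%:R.
Proof.
move=> iota2 SC H.
have E (a b c : C) : let q := twistor_coef iota a b c in
    4%:R * \sum_s \sum_t q s * q t * S s t =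
    (1 - a * a) ^+ 2 * S 0 0 + (a * b + iota * c) ^+ 2 * S 1 1
    + (a * c - iota * b) ^+ 2 * S 2%:R 2%:R
    - 2%:R * (1 - a * a) * (a * b + iota * c) * S 0 1
    - 2%:R * (1 - a * a) * (a * c - iota * b) * S 0 2%:R
    + 2%:R * (a * b + iota * c) * (a * c - iota * b) * S 1 2%:R.
  move=> q; rewrite !sum3 /q /twistor_coef /triple /=.
  rewrite (SC 1 0) (SC 2%:R 0) (SC 2%:R 1).
  by field.
(* The points are plus and minus the second unit vector, then plus and minus the third. *)
have e2 : S 0 0 + iota * iota * S 2%:R 2%:R + 2%:R * iota * S 0 2%:R = 0.
  by rewrite -[RHS](mulr0 4%:R) -(H 0 1 0 erefl) E; ring.
have e2N : S 0 0 + iota * iota * S 2%:R 2%:R - 2%:R * iota * S 0 2%:R = 0.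
  by rewrite -[RHS](mulr0 4%:R) -(H 0 (-1) 0 erefl) E; ring.
have e3 : S 0 0 + iota * iota * S 1 1 - 2%:R * iota * S 0 1 = 0.
  by rewrite -[RHS](mulr0 4%:R) -(H 0 0 1 erefl) E; ring.
have e3N : S 0 0 + iota * iota * S 1 1 + 2%:R * iota * S 0 1 = 0.
  by rewrite -[RHS](mulr0 4%:R) -(H 0 0 (-1) erefl) E; ring.
rewrite iota2 in e2 e2N e3 e3N.
have two : 2%:R != 0 :> C by rewrite pnatr_eq0.
have S02 : S 0 0 = S 2%:R 2%:R.
  apply/eqP; rewrite -subr_eq0; apply/eqP; apply: (mulfI two).
  by rewrite mulr0 -[RHS]addr0 -{1}e2 -e2N; ring.
have S01 : S 0 0 = S 1 1.
  apply/eqP; rewrite -subr_eq0; apply/eqP; apply: (mulfI two).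
  by rewrite mulr0 -[RHS]addr0 -{1}e3 -e3N; ring.
by split; [|rewrite -S01].
Qed.

Section Quaternion.
Context {C : numFieldType} {n : nat} (iota a b c : C) (I J K H : 'M[C]_n).
Hypotheses (iota2 : iota * iota = -1) (abc : a * a + b * b + c * c = 1).
Hypotheses (I2 : I *m I = - 1%:M) (J2 : J *m J = - 1%:M) (K2 : K *m K = - 1%:M).
Hypotheses (JI : J *m I = K) (IJ : I *m J = - K).
Hypotheses (IH : I^T *m H = - (H *m I)) (JH : J^T *m H = - (H *m J)).
Hypotheses (KH : K^T *m H = - (H *m K)).

Let A := a *: I + b *: J + c *: K.

(** [H] stands for the inverse metric. Moving the left projector across [H] conjugates it, as [A] is
    skew for [H]; there remains a quarter of [(1 + iota A) I (1 - iota A)], which is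
    [I + iota (A I - I A) + A I A] in the quaternions. *)
Lemma twistor_part :
  (2%:R^-1 *: (1%:M - iota *: A))^T *m (- (H *m I)) *m (2%:R^-1 *: (1%:M - iota *: A)) =
  \sum_s twistor_coef iota a b c s *: - (H *m triple I J K s).
Proof.
have KI : K *m I = - J by rewrite -JI -mulmxA I2 mulmxN mulmx1.
have JK : J *m K = - I by rewrite -JI mulmxA J2 mulNmx mul1mx.
have KJ : K *m J = I by rewrite -[K]opprK -IJ mulNmx -mulmxA J2 mulmxN mulmx1 opprK.
have IK : I *m K = J by rewrite -[K]opprK -IJ mulmxN mulmxA I2 mulNmx mul1mx opprK.
have AH : A^T *m H = - (H *m A).
  have -> : A^T = a *: I^T + b *: J^T + c *: K^T by apply/matrixP => p q; rewrite !mxE.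
  by rewrite !mulmxDl -!scalemxAl IH JH KH !mulmxDr -!scalemxAr !scalerN !opprD.
have TH : (2%:R^-1 *: (1%:M - iota *: A))^T *m H = 2%:R^-1 *: (H *m (1%:M + iota *: A)).
  have -> : (2%:R^-1 *: (1%:M - iota *: A))^T = 2%:R^-1 *: (1%:M - iota *: A^T).
    by rewrite linearZ; congr (_ *: _); rewrite linearB /= trmx1 linearZ.
  rewrite -scalemxAl; congr (_ *: _); rewrite mulmxBl mul1mx -scalemxAl AH.
  by rewrite scalerN opprK mulmxDr mulmx1 -scalemxAr.
rewrite mulmxN mulNmx mulmxA TH -!scalemxAl -scalemxAr -!mulmxA.
transitivity (H *m \sum_s (- twistor_coef iota a b c s) *: triple I J K s); last first.
  rewrite mulmx_sumr; apply: eq_bigr => s _.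
  by rewrite -scalemxAr scaleNr scalerN.
have AI : A *m I = - a *: 1%:M + b *: K - c *: J.
  rewrite /A !mulmxDl -!scalemxAl I2 JI KI !scalerN scaleNr. by [].
have IA : I *m A = - a *: 1%:M - b *: K + c *: J.
  by rewrite /A !mulmxDr -!scalemxAr I2 IJ IK !scalerN scaleNr.
(* For unit [A] this is minus the half-turn of [I] about [A], that is [I - 2 a A]; normalization is
   postponed to the last step. *)
have AIA : A *m I *m A = (b * b + c * c - a * a) *: I - (2%:R * (a * b)) *: J
    - (2%:R * (a * c)) *: K.
  have KA : K *m A = - a *: J + b *: I - c *: 1%:M.
    by rewrite /A !mulmxDr -!scalemxAr KI KJ K2 !scalerN scaleNr.
  have JA : J *m A = a *: K - b *: 1%:M - c *: I.
    by rewrite /A !mulmxDr -!scalemxAr JI JK J2 !scalerN.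
  rewrite AI !mulmxDl mulNmx -!scalemxAl mul1mx KA JA.
  by apply/matrixP => p q; rewrite !mxE; ring.
have XE (X : 'M[C]_n) : (1%:M + iota *: X) *m (I *m (1%:M - iota *: X)) =
    I + iota *: (X *m I - I *m X) + X *m I *m X.
  rewrite mulmxBr mulmx1 mulmxDl mul1mx mulmxBr -!scalemxAr -!scalemxAl mulmxA scalerA iota2.
  by apply/matrixP => p q; move: (X *m I *m X) => Y; rewrite !mxE; ring.
rewrite XE; move ZE: (I + _ + _) => Z.
rewrite !scalemxAr -mulmxN -{}ZE; congr (_ *m _).
rewrite AIA IA AI sum3 /triple /twistor_coef /=.
have h2 : 2%:R^-1 * 2%:R = 1 :> C by rewrite mulVf// pnatr_eq0.
move: (2%:R^-1) h2 => h h2.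
apply/matrixP => p q; rewrite !mxE /triple /=.
transitivity (- (h * (h * 2%:R)) * ((1 - a * a) * I p q + iota * (b * K p q - c * J p q)
    - a * b * J p q - a * c * K p q) - h * h * (a * a + b * b + c * c - 1) * I p q).
  ring.
rewrite h2 abc; ring.
Qed.

Lemma twistor_coef_null : \sum_s twistor_coef iota a b c s * twistor_coef iota a b c s = 0.
Proof.
rewrite sum3 /twistor_coef /triple /=; move: (2%:R^-1) => h.
transitivity (h * h * (1 - a * a) * (1 - (a * a + b * b + c * c))
  + h * h * (iota * iota + 1) * (b * b + c * c)); first by ring.
by rewrite abc iota2 subrr addNr !(mulr0, mul0r) addr0.
Qed.
End Quaternion.

(** * HKT and the slice bivectors in one chart *)

Section Hyper.
Context {R : realType} {n : nat} (U : set 'rV[R]_n) (oU : open U).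
Context (G I J K : 'rV[R]_n -> 'M[R]_n).
Hypotheses (sG : smooth_mx_on U G) (uG : forall v, U v -> G v \in unitmx).
Hypothesis GT : forall v, U v -> (G v)^T = G v.
Hypotheses (hI : hermitian_structure U G I) (hJ : hermitian_structure U G J)
  (hK : hermitian_structure U G K).
Hypothesis JI : forall v, U v -> J v *m I v = K v.
Hypothesis IJ : forall v, U v -> I v *m J v = - K v.
Context (u : 'rV[R]_n) (Uu : U u).

Let F := triple (dual_field G I) (dual_field G J) (dual_field G K).

Definition null_bivector (q : 'I_3 -> R[i]) v := \sum_s q s *: mxC (F s v).

Let sF s : smooth_mx_on U (F s).
Proof.
rewrite /F /triple; case: ifP => _; first exact: smooth_dual.
by case: ifP => _; exact: smooth_dual.
Qed.

Let KJ v : U v -> K v *m J v = I v.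
Proof.
move=> Uv; case: hJ => _ J2 _ _.
by rewrite -[K v]opprK -IJ// mulNmx -mulmxA J2// mulmxN mulmx1 opprK.
Qed.

Let IK v : U v -> I v *m K v = J v.
Proof.
move=> Uv; case: hI => _ I2 _ _.
by rewrite -[K v]opprK -IJ// mulmxN mulmxA I2// mulNmx mul1mx opprK.
Qed.

Lemma schouten_null q :
  (forall i j k, dc_form G u I i j k = dc_form G u J i j k /\
                 dc_form G u J i j k = dc_form G u K i j k) ->
  \sum_s q s * q s = 0 ->
  forall i j k, schouten (null_bivector q) (null_bivector q) u i j k = 0.
Proof.
move=> hkt q0 i j k.
have eIJ := (dual_bracket_eq oU sG uG GT Uu hI hJ).1 (fun i j k => (hkt i j k).1).
have eJK := (dual_bracket_eq oU sG uG GT Uu hJ hK).1 (fun i j k => (hkt i j k).2).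
have eKI i' j' k' := esym (etrans (eIJ i' j' k') (eJK i' j' k')).
(* The three mixed brackets come from the cyclic relations [J I = K], [K J = I] and [I K = J] in the
   row convention. *)
have JK0 := dual_bracket_mixed oU sG uG GT Uu hI hJ hK JI eJK i j k.
have KI0 := dual_bracket_mixed oU sG uG GT Uu hJ hK hI KJ eKI i j k.
have IJ0 := dual_bracket_mixed oU sG uG GT Uu hK hI hJ IK eIJ i j k.
rewrite (schouten_comb Uu q i j k sF).
pose S s t := sch_jet (mxC (F s u)) (mxC (F t u))
  (fun l => mxC (pmx l (F s) u)) (fun l => mxC (pmx l (F t) u)) i j k.
have SC s t : S s t = S t s := sch_jetC _ _ _ _ _ _ _.
exact: (null_sum SC IJ0 JK0 KI0 (esym (eIJ i j k)) (eKI i j k) q0).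
Qed.

Lemma null_schouten :
  (forall a b c : int, a * a + b * b + c * c = 1 -> forall i j k,
    let Q := null_bivector (twistor_coef 'i a%:~R b%:~R c%:~R) in
    schouten Q Q u i j k = 0) ->
  forall i j k, dc_form G u I i j k = dc_form G u J i j k /\
                dc_form G u J i j k = dc_form G u K i j k.
Proof.
move=> H.
have D i j k : dual_bracket G u I I i j k = dual_bracket G u J J i j k /\
    dual_bracket G u J J i j k = dual_bracket G u K K i j k.
  pose S s t := sch_jet (mxC (F s u)) (mxC (F t u))
    (fun l => mxC (pmx l (F s) u)) (fun l => mxC (pmx l (F t) u)) i j k.
  have SC s t : S s t = S t s := sch_jetC _ _ _ _ _ _ _.
  have [h1 h2] := (twistor_sum_diag mulii SC (fun a b c abc =>
    etrans (esym (schouten_comb Uu _ i j k sF)) (H a b c abc i j k))).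
  split; [exact: h1|exact: h2].
move=> i j k; split.
  exact: (dual_bracket_eq oU sG uG GT Uu hI hJ).2 (fun i j k => (D i j k).1) i j k.
exact: (dual_bracket_eq oU sG uG GT Uu hJ hK).2 (fun i j k => (D i j k).2) i j k.
Qed.

End Hyper.

(** * Product charts and the sphere *)

Section ProductPartial.
Context {R : realType} {m n : nat}.
Implicit Types (u : 'rV[R]_(m + n)).

Lemma partial_lshift i (F : 'rV[R]_(m + n) -> R) u :
  partial (lshift n i) F u = partial i (fun w => F (row_mx w (rsubmx u))) (lsubmx u).
Proof.
rewrite /partial /derive.
set f := (fun h => _); set g := (fun h => _); suff -> : f = g by [].
apply/funext => h; rewrite /f /g /=; congr (h^-1 *: (F _ - F _)); last by rewrite hsubmxK.
rewrite -[LHS]hsubmxK; congr row_mx; apply/rowP => j; rewrite !mxE eqxx /=.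
  by rewrite (inj_eq (@lshift_inj _ _)).
by rewrite eq_rlshift mulr0 add0r.
Qed.

Lemma partial_rshift i (F : 'rV[R]_(m + n) -> R) u :
  partial (rshift m i) F u = partial i (fun w => F (row_mx (lsubmx u) w)) (rsubmx u).
Proof.
rewrite /partial /derive.
set f := (fun h => _); set g := (fun h => _); suff -> : f = g by [].
apply/funext => h; rewrite /f /g /=; congr (h^-1 *: (F _ - F _)); last by rewrite hsubmxK.
rewrite -[LHS]hsubmxK; congr row_mx; apply/rowP => j; rewrite !mxE eqxx /=.
  by rewrite eq_lrshift mulr0 add0r.
by rewrite (inj_eq (@rshift_inj _ _)).
Qed.

Lemma partial_lsubmx i (f : 'rV[R]_m -> R) u :
  partial (lshift n i) (fun v => f (lsubmx v)) u = partial i f (lsubmx u).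
Proof.
by rewrite partial_lshift; under eq_fun do rewrite row_mxKl.
Qed.

Lemma partial_lsubmx0 i (f : 'rV[R]_m -> R) u :
  partial (rshift m i) (fun v => f (lsubmx v)) u = 0.
Proof.
by rewrite partial_rshift; under eq_fun do rewrite row_mxKl; rewrite partial_cst.
Qed.

Lemma partial_rsubmx0 i (f : 'rV[R]_n -> R) u :
  partial (lshift n i) (fun v => f (rsubmx v)) u = 0.
Proof.
by rewrite partial_lshift; under eq_fun do rewrite row_mxKr; rewrite partial_cst.
Qed.

Lemma open_lsubmx (U : set 'rV[R]_m) : open U -> open [set v : 'rV[R]_(m + n) | U (lsubmx v)].
Proof.
by move=> oU; apply: (open_comp _ oU) => v _; exact: continuous_lsubmx.
Qed.

(** Functions pulled back from the first factor are closed under derivatives: along the first factor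
    the derivative is again pulled back, along the second it is zero. *)
Lemma smooth_lsubmx (U : set 'rV[R]_m) f : open U -> smooth_on U f ->
  smooth_on [set v : 'rV[R]_(m + n) | U (lsubmx v)] (fun v => f (lsubmx v)).
Proof.
move=> oU sf; pose F (h : 'rV[R]_(m + n) -> R) :=
  exists2 f, smooth_on U f & h = fun v => f (lsubmx v).
apply: (@smooth_coinduction _ _ _ F (open_lsubmx oU)); last by exists f.
  move=> h [f' sf' ->] u Uu.
  by apply: differentiable_comp; [exact: differentiable_lsubmx|exact: smooth_differentiable sf' Uu].
move=> h [f' sf' ->] i.
case: (splitP i) => j ij.
  have -> : i = lshift n j by exact/val_inj.
  exists (fun v => partial j f' (lsubmx v)).
    by exists (partial j f') => //; exact: smooth_partial.
  by move=> u _; rewrite partial_lsubmx.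
have -> : i = rshift m j by exact/val_inj.
exists (fun=> 0); first by exists (fun=> 0) => //; exact: smooth_cst.
by move=> u _; rewrite partial_lsubmx0.
Qed.

End ProductPartial.

(** * Stereographic charts *)

Section Sphere.
Context {R : realType}.
Implicit Types (a : sphere R) (w : 'rV[R]_2).

Lemma sphereE a : val a 0 0 * val a 0 0 + val a 0 1 * val a 0 1 + val a 0 2%:R * val a 0 2%:R = 1.
Proof. by have /eqP := valP a; rewrite sum3 !expr2. Qed.

Lemma sign2 (b : bool) : (-1) ^+ b * (-1) ^+ b = 1 :> R.
Proof. by case: b; rewrite ?mulrNN mulr1. Qed.

Lemma sphere_dom_neq0 b a : dom (sphere_atlas R) b a -> 1 - (-1) ^+ b * val a 0 2%:R != 0.
Proof.
apply: contra => /eqP e; apply/eqP.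
by move/eqP: e; rewrite subr_eq0 => /eqP/(congr1 (fun x => (-1) ^+ b * x)); rewrite mulr1 mulrA sign2 mul1r.
Qed.

Lemma sphere_dom_cover a : exists b, dom (sphere_atlas R) b a.
Proof.
have [e|e] := eqVneq (val a 0 2%:R) ((-1) ^+ false); last by exists false.
by exists true; rewrite /= e expr0 expr1 -subr_eq0 opprK -mulr2n pnatr_eq0.
Qed.

Lemma sq_norm1_neq0 w : w 0 0 ^+ 2 + w 0 1 ^+ 2 + 1 != 0.
Proof. by rewrite gt_eqF// ltr_wpDl// addr_ge0// sqr_ge0. Qed.

Lemma stereo_invE b w :
  let r := w 0 0 ^+ 2 + w 0 1 ^+ 2 in
  [/\ stereo_inv_vec b w 0 0 = 2%:R * w 0 0 / (r + 1),
      stereo_inv_vec b w 0 1 = 2%:R * w 0 1 / (r + 1)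
    & stereo_inv_vec b w 0 2%:R = (-1) ^+ b * (r - 1) / (r + 1)].
Proof. by split; rewrite mxE. Qed.

Lemma stereo_invK b a : dom (sphere_atlas R) b a -> stereo_inv b (stereo b a) = a.
Proof.
move=> /sphere_dom_neq0; have := sphereE a; move=> s1 d0; apply/val_inj => /=.
have [e0 e1 e2] := stereo_invE b (stereo b a).
have sE : stereo b a 0 0 = val a 0 0 / (1 - (-1) ^+ b * val a 0 2%:R) by rewrite mxE.
have sE' : stereo b a 0 1 = val a 0 1 / (1 - (-1) ^+ b * val a 0 2%:R) by rewrite mxE.
move: s1 e0 e1 e2 d0 sE sE'; move: (stereo b a) => w; set x := val a 0 0.
set y := val a 0 1; set z := val a 0 2%:R => s1.
set s := (-1) ^+ b; have ss : s * s = 1 by exact: sign2.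
move=> e0 e1 e2 d0 sE sE'.
(* The squared length of the stereographic coordinates plus one; it follows from
   [x^2 + y^2 = 1 - z^2] and inverts all three formulas. *)
have r1 : w 0 0 ^+ 2 + w 0 1 ^+ 2 + 1 = 2%:R / (1 - s * z).
  rewrite sE sE'; apply: (mulIf (mulf_neq0 d0 d0)).
  transitivity (x * x + y * y + (1 - s * z) * (1 - s * z)); first by field.
  transitivity ((x * x + y * y + z * z) + 1 - 2%:R * (s * z) + (s * s - 1) * (z * z)).
    by ring.
  by rewrite s1 ss subrr mul0r; field.
have r1' : w 0 0 ^+ 2 + w 0 1 ^+ 2 - 1 = 2%:R / (1 - s * z) - 2%:R.
  by rewrite -r1; ring.
rewrite r1 sE in e0; rewrite r1 sE' in e1; rewrite r1 r1' in e2.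
have {}e0 : stereo_inv_vec b w 0 0 = x by rewrite e0; field; rewrite d0.
have {}e1 : stereo_inv_vec b w 0 1 = y by rewrite e1; field; rewrite d0.
have {}e2 : stereo_inv_vec b w 0 2%:R = z.
  by rewrite e2; transitivity ((s * s) * z); [field; rewrite d0|rewrite ss mul1r].
apply/rowP => -[[|[|[|]]]]//= p.
- by rewrite (_ : Ordinal p = 0)//; apply/val_inj.
- by rewrite (_ : Ordinal p = 1)//; apply/val_inj.
- by rewrite (_ : Ordinal p = 2%:R)//; apply/val_inj.
Qed.

Lemma smooth_stereo_inv n (V : set 'rV[R]_n) (F : 'rV[R]_n -> 'rV[R]_2) b k : open V ->
  smooth_mx_on V F -> smooth_on V (fun v => stereo_inv_vec b (F v) 0 k).
Proof.
move=> oV sF.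
have sr : smooth_on V (fun v => F v 0 0 ^+ 2 + F v 0 1 ^+ 2).
  by apply: smoothD => //; apply: smoothM => //; exact: sF.
have s0 j : smooth_on V (fun v => 2%:R * F v 0 j).
  by apply: smoothM => //; exact: smooth_cst.
have sV : smooth_on V (fun v => (F v 0 0 ^+ 2 + F v 0 1 ^+ 2 + 1)^-1).
  apply: smoothV => // [w _|]; first exact: sq_norm1_neq0.
  by apply: smoothD => //; exact: smooth_cst.
pose N v : R := [:: 2 * F v 0 0; 2 * F v 0 1;
  (-1) ^+ b * (F v 0 0 ^+ 2 + F v 0 1 ^+ 2 - 1)]`_k.
apply: (@smooth_eq _ _ _ (fun v => N v * (F v 0 0 ^+ 2 + F v 0 1 ^+ 2 + 1)^-1)) => //.
  by move=> v _; rewrite mxE.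
apply: smoothM => //; rewrite /N {N}; case: k => [[|[|[|]]]]//= _ ; try exact: s0.
apply: smoothM => //; first exact: smooth_cst.
by apply: smoothD => //; exact: smooth_cst.
Qed.

(** Needed to read the jacobian of a transition of the twistor space entrywise as partial
    derivatives. *)
Lemma sphere_transition_differentiable b b' a :
  dom (sphere_atlas R) b a -> dom (sphere_atlas R) b' a ->
  differentiable (stereo b' \o stereo_inv b) (stereo b a).
Proof.
move=> ba b'a; apply: differentiable_mx => k.
have dV j : differentiable (fun w => stereo_inv_vec b w 0 j) (stereo b a).
  have sid : smooth_mx_on setT (fun w : 'rV[R]_2 => w).
    by move=> i l; rewrite (ord1 i); apply: smooth_coord; exact: openT.
  exact: smooth_differentiable (smooth_stereo_inv b j openT sid) I.
rewrite (_ : (fun _ => _) = fun w => ([:: stereo_inv_vec b w 0 0; stereo_inv_vec b w 0 1]`_k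
    * (1 - (-1) ^+ b' * stereo_inv_vec b w 0 2%:R)^-1)); last first.
  by apply/funext => w; rewrite mxE.
apply: differentiableM.
  by case: k => [[|[|]]]//= _; exact: dV.
apply: differentiableV.
  by apply: differentiableB => //; apply: differentiableM.
have /(congr1 val)/= -> := stereo_invK ba.
exact: sphere_dom_neq0.
Qed.

End Sphere.

(** * Bivectors tangent to the first factor of a product *)

Section Blocks.
Context {R : realType} {n m : nat}.

Lemma type_proj_block (A : 'M[R]_n) (S : 'M[R]_m) b :
  type_proj (block_mx A 0 0 S) b = block_mx (type_proj A b) 0 0 (type_proj S b).
Proof.
have mxCb : mxC (block_mx A 0 0 S) = block_mx (mxC A) 0 0 (mxC S).
  by rewrite /mxC map_block_mx -!/(mxC _) !mxC0.
rewrite /type_proj mxCb scalar_mx_block; case: b.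
  by rewrite !scale_block_mx opp_block_mx add_block_mx scale_block_mx !(scaler0, oppr0, addr0).
by rewrite !scale_block_mx add_block_mx scale_block_mx !(scaler0, addr0).
Qed.

Lemma bivector20_block (A : 'M[R]_n) (S : 'M[R]_m) Q :
  bivector20 (block_mx A 0 0 S) (block_mx Q 0 0 0) = block_mx (bivector20 A Q) 0 0 0.
Proof.
rewrite /bivector20 type_proj_block tr_block_mx !trmx0 !mulmx_block.
by rewrite !(mul0mx, mulmx0, addr0).
Qed.

Lemma type_proj_idem (A : 'M[R]_n) : A *m A = - 1%:M ->
  type_proj A true *m type_proj A true = type_proj A true.
Proof.
move=> A2; have A2C : mxC A *m mxC A = - 1%:M by rewrite -mxCM A2 mxCN mxC1.
have E : (1%:M - 'i *: mxC A) *m (1%:M - 'i *: mxC A) = 2%:R *: (1%:M - 'i *: mxC A).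
  rewrite mulmxBl mul1mx !mulmxBr mulmx1 -!scalemxAl -scalemxAr A2C scalerA mulii.
  by rewrite scaleN1r opprK; apply/matrixP => i j; rewrite !mxE; ring.
rewrite /type_proj -scalemxAl -scalemxAr E !scalerA; congr (_ *: _).
by rewrite -mulrA mulVf ?mulr1 ?pnatr_eq0.
Qed.

Lemma bivector20_idem (A : 'M[R]_n) P : A *m A = - 1%:M ->
  bivector20 A (bivector20 A P) = bivector20 A P.
Proof.
move=> A2; rewrite /bivector20 !mulmxA -trmx_mul type_proj_idem//.
by rewrite -[_ *m type_proj A true *m _]mulmxA type_proj_idem.
Qed.

Context (P : 'rV[R]_(n + m) -> 'M[R[i]]_(n + m)) (Q : 'rV[R]_n -> 'M[R[i]]_n).
Context (U : set 'rV[R]_n) (oU : open U) (u : 'rV[R]_(n + m)) (Uu : U (lsubmx u)).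
Hypothesis PQ : forall w, U w -> P (row_mx w (rsubmx u)) = block_mx (Q w) 0 0 0.

Let dQ l : 'M[R[i]]_n := \matrix_(j, k) cpartial l (fun w => Q w j k) (lsubmx u).

Let cpartial_block l j k :
  cpartial (lshift m l) (fun v => P v j k) u = block_mx (dQ l) 0 0 0 j k.
Proof.
have -> : cpartial (lshift m l) (fun v => P v j k) u =
    cpartial l (fun w => P (row_mx w (rsubmx u)) j k) (lsubmx u).
  by rewrite /cpartial !partial_lshift.
transitivity (cpartial l (fun w => block_mx (Q w) 0 0 0 j k : R[i]) (lsubmx u)).
  by apply: (cpartial_near_eq oU Uu) => v Uv; rewrite PQ.
have c0 : cpartial l (fun=> 0) (lsubmx u) = 0 :> R[i].
  by rewrite /cpartial !partial_cst.
case: (split_ordP j) => {}j ->; case: (split_ordP k) => {}k ->.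
- by rewrite block_mxEul mxE; under eq_fun do rewrite block_mxEul.
- by rewrite block_mxEur mxE; under eq_fun do rewrite block_mxEur mxE.
- by rewrite block_mxEdl mxE; under eq_fun do rewrite block_mxEdl mxE.
- by rewrite block_mxEdr mxE; under eq_fun do rewrite block_mxEdr mxE.
Qed.

(** Knowing [P] on the slice through [u] is enough: derivatives across the slice are multiplied by
    zero entries of [P]. An index in the second factor kills each cyclic term, either through the
    undifferentiated factor or because the differentiated entry is constantly zero along the
    slice. *)
Lemma schouten_block :
  (forall i j k, schouten P P u i j k = 0) <->
  (forall i j k, schouten Q Q (lsubmx u) i j k = 0).
Proof.
pose t i j k := \sum_(l < n) (Q (lsubmx u) i l * dQ l j k + Q (lsubmx u) i l * dQ l j k).
have Pu : P u = block_mx (Q (lsubmx u)) 0 0 0 by rewrite -PQ// hsubmxK.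
pose T i j k := \sum_(l < n + m) (P u i l * cpartial l (fun v => P v j k) u
                  + P u i l * cpartial l (fun v => P v j k) u).
have T0 i j k : T (rshift n i) j k = 0.
  rewrite /T big1// => l _; rewrite Pu.
  by case: (split_ordP l) => {}l ->; rewrite ?block_mxEdl ?block_mxEdr mxE mul0r addr0.
have TE i j k : T (lshift m i) j k =
    \sum_(l < n) (Q (lsubmx u) i l * block_mx (dQ l) 0 0 0 j k
                  + Q (lsubmx u) i l * block_mx (dQ l) 0 0 0 j k).
  rewrite /T big_split_ord /= [X in _ + X]big1 ?addr0 => [|l _].
    by apply: eq_bigr => l _; rewrite cpartial_block Pu block_mxEul.
  by rewrite Pu block_mxEur mxE mul0r addr0.
have Tr i j k : T i (rshift n j) k = 0.
  case: (split_ordP i) => {}i ->; last exact: T0.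
  rewrite TE big1// => l _.
  by case: (split_ordP k) => {}k ->; rewrite ?block_mxEdl ?block_mxEdr mxE mulr0 addr0.
have Trr i j k : T i j (rshift n k) = 0.
  case: (split_ordP i) => {}i ->; last exact: T0.
  rewrite TE big1// => l _.
  by case: (split_ordP j) => {}j ->; rewrite ?block_mxEur ?block_mxEdr mxE mulr0 addr0.
have Tl i j k : T (lshift m i) (lshift m j) (lshift m k) = t i j k.
  by rewrite TE; apply: eq_bigr => l _; rewrite block_mxEul.
have SP i j k : schouten P P u i j k = T i j k + T j k i + T k i j by [].
have SQ i j k : schouten Q Q (lsubmx u) i j k = t i j k + t j k i + t k i j.
  by rewrite /schouten /t; congr (_ + _ + _); apply: eq_bigr => l _; rewrite mxE.
split=> H i j k.
  by rewrite SQ -!Tl -SP H.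
rewrite SP; case: (split_ordP i) => {}i ->; last by rewrite T0 Tr Trr !addr0.
case: (split_ordP j) => {}j ->; last by rewrite T0 Tr Trr !addr0.
case: (split_ordP k) => {}k ->; last by rewrite T0 Tr Trr !addr0.
by rewrite !Tl -SQ H.
Qed.

End Blocks.

(** * The twistor space *)

Lemma posdef_unit (R : realFieldType) n (G : 'M[R]_n) :
  (forall v : 'rV_n, v != 0 -> 0 < (v *m G *m v^T) 0 0) -> G \in unitmx.
Proof.
move=> G0; rewrite unitmxE unitfE; apply/det0P => -[v v0 vG].
by have := G0 v v0; rewrite vG mul0mx mxE ltxx.
Qed.

Section Charts.
Context {R : realType} {n : nat} (M : atlas R n) (hM : smooth_manifold M).

Lemma coordK i (x : M) : dom M i x -> param M i (coord M i x) = x.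
Proof. by case: hM => _ + _ _ _; apply. Qed.

Lemma chart_open i : open (chart_image (M := M) i).
Proof. by case: hM => _ _ /(_ i i)[] + _ _ _; rewrite setIid. Qed.

Lemma chart_imageP i u : chart_image (M := M) i u ->
  dom M i (param M i u) /\ coord M i (param M i u) = u.
Proof. by case=> x dx <-; rewrite coordK. Qed.

Lemma transition_differentiable i j (x : M) : dom M i x -> dom M j x ->
  differentiable (transition (M := M) i j) (coord M i x).
Proof.
move=> dix djx; case: hM => _ _ /(_ i j)[_ sT] _ _.
apply: differentiable_mx => k; apply: smooth_differentiable (sT 0 k) _.
by exists x.
Qed.

Context (g : components M R).
Hypothesis hg : riemannian_metric g.

Lemma metric_unit i (x : M) : dom M i x -> g i x \in unitmx.
Proof. by move=> dx; apply: posdef_unit => v v0; case: hg => _ _; apply. Qed.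

Lemma metric_chart i : [/\ smooth_mx_on (chart_image i) (in_chart g i),
  forall v, chart_image i v -> in_chart g i v \in unitmx
  & forall v, chart_image i v -> (in_chart g i v)^T = in_chart g i v].
Proof.
case: (hg) => -[_ sg] gT _; split=> // v /chart_imageP[dv _].
  exact: metric_unit.
exact: gT.
Qed.

Lemma hermitian_chart (A : components M R) i : complex_structure A -> hermitian A g ->
  hermitian_structure (chart_image i) (in_chart g i) (in_chart A i).
Proof.
move=> [[_ sA] A2 nA] hA; split=> //.
- by move=> v /chart_imageP[dv _]; exact: A2.
- by move=> X Y sX sY v Uv; exact: nA.
- by move=> v /chart_imageP[dv _]; exact: hA.
Qed.

Lemma dual_bivector_transition (A : components M R) i j (x : M) :
  complex_structure A -> dom M i x -> dom M j x ->
  let D := 'J (transition i j) (coord M i x) in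
  dual_bivector (fundamental_form A g) j x =
  D^T *m dual_bivector (fundamental_form A g) i x *m D.
Proof.
move=> [[AD _] A2 _] dix djx D.
have [[gD _] _ _] := hg.
have eA : A i x *m D = D *m A j x := AD i j x dix djx.
have eg : g i x = D *m g j x *m D^T := gD i j x dix djx.
have uA k : dom M k x -> A k x *m g k x \in unitmx.
  move=> dk; rewrite unitmx_mul metric_unit// andbT.
  have /mulmx1_unit[] // : A k x *m (- A k x) = 1%:M.
  by rewrite mulmxN A2// opprK.
have e : A i x *m g i x = D *m (A j x *m g j x) *m D^T.
  by rewrite eg !mulmxA eA.
rewrite /dual_bivector /fundamental_form e.
(* Invertibility of the jacobian is read off from its being a factor of a nondegenerate form. *)
have uj := uA j djx; have := uA i dix; rewrite e unitmx_mul unitmx_tr => /andP[_ uD].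
have ui : D *m (A j x *m g j x) *m D^T \in unitmx by rewrite -e uA.
move: (A j x *m g j x) uj ui => W uj ui.
apply: (can_inj (mulKmx uj)); rewrite mulmxV//.
apply: (can_inj (mulKmx uD)); rewrite mulmx1 !mulmxA.
by rewrite mulmxV ?mul1mx// -mulmxA.
Qed.

End Charts.

Section Twistor.
Context {R : realType} {n : nat} (M : atlas R n).
Context (hM : smooth_manifold M) (I J K g : components M R).
Hypotheses (hIJK : hypercomplex I J K) (hg : hyperhermitian I J K g).

Let Z := twistor_space M.

Lemma pushforward_section i b (x : M) (a : sphere R) Q : dom M i x ->
  pushforward_bivector (N := Z) (sphere_section a) i (i, b) x Q = block_mx Q 0 0 0.
Proof.
move=> dx; rewrite /pushforward_bivector.
set f := _ \o param M i; set u := coord M i x.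
have Uu : chart_image i u by exists x.
(* In these charts the section is an affine inclusion, but only on the chart image, where [param] is
   not junk; since that image is open, agreement there determines the jacobian. *)
have fE v : chart_image i v -> f v = row_mx v (stereo b a).
  by move=> /(chart_imageP hM)[_ cv]; rewrite /f /= cv.
have fj j w : chart_image i w -> f w 0 j = row_mx w (stereo b a) 0 j by move=> /fE ->.
have df : differentiable f u.
  apply: differentiable_mx => j.
  apply: near_eq_differentiable (_ : differentiable (fun w => row_mx w (stereo b a) 0 j) u).
    have := open_nbhs_nbhs (conj (chart_open hM (i:=i)) Uu).
    by apply: filterS => w Uw /=; rewrite fE.
  case: (split_ordP j) => {}j ->.
    by under eq_fun do rewrite row_mxEl; exact: differentiable_coord.
  by under eq_fun do rewrite row_mxEr; exact: differentiable_cst.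
have -> : 'J f u = row_mx 1%:M 0.
  apply/matrixP => p q; rewrite jacobianE//.
  rewrite (partial_near_eq p (chart_open hM (i:=i)) Uu (fj q)).
  case: (split_ordP q) => {}q ->.
    by rewrite row_mxEl mxE; under eq_fun do rewrite row_mxEl; rewrite partial_coord.
  by rewrite row_mxEr mxE; under eq_fun do rewrite row_mxEr; rewrite partial_cst.
rewrite tr_row_mx trmx1 trmx0 mul_col_mx mul1mx mul0mx mul_col_mx !mul_mx_row.
by rewrite !mulmx1 !mulmx0 block_mxEv.
Qed.

Definition sphere_coef (a : sphere R) : 'I_3 -> R[i] :=
  twistor_coef 'i (val a 0 0)%:C (val a 0 1)%:C (val a 0 2%:R)%:C.

Definition twistor_slice i (a : sphere R) :=
  null_bivector (in_chart g i) (in_chart I i) (in_chart J i) (in_chart K i) (sphere_coef a).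

Lemma sphere_sum1 (a : sphere R) :
  (val a 0 0)%:C * (val a 0 0)%:C + (val a 0 1)%:C * (val a 0 1)%:C
  + (val a 0 2%:R)%:C * (val a 0 2%:R)%:C = 1.
Proof. by rewrite -!rmorphM -!rmorphD sphereE rmorph1. Qed.

(** The structure on [Z] is block diagonal, so the (2,0) part is taken in the block of [M] alone,
    with respect to the structure at [a]; there [twistor_part] applies with the inverse metric as
    [H]. *)
Lemma twistor_bivectorE i b u a : chart_image i u ->
  twistor_bivector I J K g (i, b) (param M i u, a) = block_mx (twistor_slice i a u) 0 0 0.
Proof.
move=> Uu; have [du cu] := chart_imageP hM Uu.
have [hI hJ hK q] := hIJK; have [hr gI gJ gK] := hg.
have [sg ug gT] := metric_chart hM hr i.
have HI := hermitian_chart hM i hI gI.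
have HJ := hermitian_chart hM i hJ gJ.
have HK := hermitian_chart hM i hK gK.
rewrite /twistor_bivector pushforward_section//.
rewrite /twistor_structure.
have -> : mxC (block_mx (dual_bivector (fundamental_form I g) i (param M i u)) 0 0 0 : 'M[R]_(n + 2)) =
  block_mx (mxC (dual_bivector (fundamental_form I g) i (param M i u))) 0 0 0.
  by rewrite /mxC map_block_mx -!/(mxC _) !mxC0.
rewrite bivector20_block; congr block_mx.
set v := param M i u; set h := mxC (invmx (g i v)).
have dE A : hermitian_structure (chart_image i) (in_chart g i) (in_chart A i) ->
    mxC (dual_field (in_chart g i) (in_chart A i) u) = - (h *m mxC (A i v)).
  by move=> hA; rewrite (dualE ug hA Uu) mxCN mxCM.
have uC A : complex_structure A -> mxC (A i v) *m mxC (A i v) = - 1%:M.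
  by case=> _ A2 _; rewrite -mxCM A2// mxCN mxC1.
have AH A : complex_structure A -> hermitian A g -> (mxC (A i v))^T *m h = - (h *m mxC (A i v)).
  move=> cA hA; have HA := hermitian_chart hM i cA hA.
  have Ag := hermitian_skew HA Uu; have uv := ug u Uu.
  have : in_chart g i u *m (in_chart A i u)^T = - (in_chart A i u *m in_chart g i u).
    by rewrite Ag opprK.
  (* Multiplying the skewness relation of the metric by its inverse on both sides gives the one for
     the inverse metric. *)
  move=> /(congr1 (fun X => invmx (in_chart g i u) *m X *m invmx (in_chart g i u))).
  rewrite mulKmx// mulmxN mulNmx !mulmxA mulmxK// => e.
  by rewrite -mxC_tr -!mxCM -mxCN; congr mxC.
have [JI IJ] := q i v du.
have JIC : mxC (J i v) *m mxC (I i v) = mxC (K i v) by rewrite -mxCM JI.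
have IJC : mxC (I i v) *m mxC (J i v) = - mxC (K i v) by rewrite -mxCM IJ mxCN.
have AE : mxC (sphere_combination I J K a i v) = (val a 0 0)%:C *: mxC (I i v)
    + (val a 0 1)%:C *: mxC (J i v) + (val a 0 2%:R)%:C *: mxC (K i v).
  by rewrite /sphere_combination !mxCD !mxCZ.
rewrite /bivector20 /type_proj AE -[mxC (dual_bivector _ _ _)]/(mxC (dual_field (in_chart g i) (in_chart I i) u)).
rewrite (dE I HI).
rewrite (twistor_part mulii (sphere_sum1 a) (uC I hI) (uC J hJ) (uC K hK) JIC IJC
  (AH I hI gI) (AH J hJ gJ) (AH K hK gK)).
rewrite /twistor_slice /null_bivector; apply: eq_bigr => s _; congr (_ *: _).
rewrite /triple; case: ifP => _; first by rewrite dE.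
by case: ifP => _; rewrite dE.
Qed.
End Twistor.

Section Field.
Context {R : realType} {n : nat} (M : atlas R n).
Context (hM : smooth_manifold M) (I J K g : components M R).
Hypotheses (hIJK : hypercomplex I J K) (hg : hyperhermitian I J K g).

Let Z := twistor_space M.
Let P := twistor_bivector I J K g.

Lemma twistor_chart_image i b u : chart_image (M := Z) (i, b) u -> chart_image i (lsubmx u).
Proof. by move=> [[x a] /= [dx da] <-]; rewrite row_mxKl; exists x. Qed.

Lemma twistor_pointE i b (x : M) (a : sphere R) : dom M i x ->
  P (i, b) (x, a) = block_mx (twistor_slice I J K g i a (coord M i x)) 0 0 0.
Proof.
move=> dx; rewrite -(twistor_bivectorE hM hIJK hg b a (u := coord M i x)); last by exists x.
by rewrite coordK.
Qed.

Lemma twistor_sliceT i a v : chart_image i v ->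
  (twistor_slice I J K g i a v)^T = - twistor_slice I J K g i a v.
Proof.
move=> Uv; have [hI hJ hK q] := hIJK; have [hr gI gJ gK] := hg.
have [sg ug gT] := metric_chart hM hr i.
rewrite /twistor_slice /null_bivector raddf_sum -sumrN; apply: eq_bigr => s _.
rewrite -scalerN; apply: etrans (linearZ _ _) _; congr (_ *: _).
rewrite -mxCN; apply: etrans (esym (mxC_tr _)) _; congr mxC.
rewrite /triple; case: ifP => _.
  exact: (dual_skew ug gT (hermitian_chart hM i hI gI)).
case: ifP => _.
  exact: (dual_skew ug gT (hermitian_chart hM i hJ gJ)).
exact: (dual_skew ug gT (hermitian_chart hM i hK gK)).
Qed.

Lemma twistor_slice_transition i j a (x : M) : dom M i x -> dom M j x ->
  let D := mxC ('J (transition i j) (coord M i x)) in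
  twistor_slice I J K g j a (coord M j x) = D^T *m twistor_slice I J K g i a (coord M i x) *m D.
Proof.
move=> dix djx D; have [hI hJ hK q] := hIJK; have [hr gI gJ gK] := hg.
have E A : complex_structure A -> mxC (dual_field (in_chart g j) (in_chart A j) (coord M j x)) =
    D^T *m mxC (dual_field (in_chart g i) (in_chart A i) (coord M i x)) *m D.
  move=> hA; rewrite -mxC_tr -!mxCM; congr mxC.
  rewrite /dual_field /in_chart !coordK//.
  exact: (dual_bivector_transition hr hA dix djx).
rewrite /twistor_slice /null_bivector mulmx_sumr mulmx_suml; apply: eq_bigr => s _.
rewrite -scalemxAr -scalemxAl; congr (_ *: _).
rewrite /triple; case: ifP => _; first exact: E.
by case: ifP => _; exact: E.
Qed.

(** Sphere coordinates of the target do not depend on the point of [M], hence the zero block. The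
    lower blocks stay unspecified because the transformation law multiplies them by zero blocks of
    the bivector. *)
Lemma twistor_jacobian i j b b' (x : M) (a : sphere R) :
  dom Z (i, b) (x, a) -> dom Z (j, b') (x, a) ->
  exists X Y, 'J (transition (M := Z) (i, b) (j, b')) (coord Z (i, b) (x, a)) =
    block_mx ('J (transition i j) (coord M i x)) 0 X Y.
Proof.
move=> [/= dix da] [/= djx da'].
set p := row_mx _ _; set f := transition _ _.
have pl : lsubmx p = coord M i x by rewrite row_mxKl.
have pr : rsubmx p = stereo b a by rewrite row_mxKr.
have fl v (q : 'I_n) : f v 0 (lshift 2 q) = transition i j (lsubmx v) 0 q by rewrite row_mxEl.
have fr v (q : 'I_2) : f v 0 (rshift n q) = (stereo b' \o stereo_inv b) (rsubmx v) 0 q.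
  by rewrite row_mxEr.
have d1 := transition_differentiable hM dix djx.
have d2 := sphere_transition_differentiable da da'.
have df : differentiable f p.
  apply: differentiable_mx => q; case: (split_ordP q) => {}q ->.
    under eq_fun do rewrite fl.
    apply: (differentiable_comp (f := lsubmx) (g := fun w => transition i j w 0 q)).
      exact: differentiable_lsubmx.
    rewrite pl; apply: (differentiable_comp (g := fun w : 'rV[R]_n => w 0 q) d1).
    exact: differentiable_coord.
  under eq_fun do rewrite fr.
  apply: (differentiable_comp (f := rsubmx) (g := fun w => (stereo b' \o stereo_inv b) w 0 q)).
    exact: differentiable_rsubmx.
  rewrite pr; apply: (differentiable_comp (g := fun w : 'rV[R]_2 => w 0 q) d2).
  exact: differentiable_coord.
exists (dlsubmx ('J f p)), (drsubmx ('J f p)).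
rewrite -[LHS]submxK; congr (block_mx _ _ _ _); apply/matrixP => r q.
  rewrite mxE mxE jacobianE// jacobianE// -pl.
  under eq_fun do rewrite fl.
  by rewrite (partial_lsubmx r (fun w => transition i j w 0 q)).
rewrite mxE mxE jacobianE// [RHS]mxE.
under eq_fun do rewrite fr.
by rewrite (partial_rsubmx0 r (fun w => (stereo b' \o stereo_inv b) w 0 q)).
Qed.

Lemma twistor_bivector_transition : forall k l z, dom Z k z -> dom Z l z ->
  let D := mxC ('J (transition k l) (coord Z k z)) in P l z = D^T *m P k z *m D.
Proof.
move=> [i b] [j b'] [x a] dk dl; have [X [Y ->]] := twistor_jacobian dk dl.
case: (dk) (dl) => /= dix _ [djx _].
rewrite !twistor_pointE// (twistor_slice_transition a dix djx).
rewrite /mxC map_block_mx -!/(mxC _) tr_block_mx !mulmx_block mxC0 trmx0.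
by rewrite !(mul0mx, mulmx0, addr0).
Qed.

Lemma smooth_triple (U : set 'rV[R]_n) m (x y z : 'rV[R]_n -> 'M[R]_m) s :
  smooth_mx_on U x -> smooth_mx_on U y -> smooth_mx_on U z ->
  smooth_mx_on U (triple x y z s).
Proof. by rewrite /triple; case: ifP => // _; case: ifP. Qed.

Definition dual_triple i :=
  triple (dual_field (in_chart g i) (in_chart I i)) (dual_field (in_chart g i) (in_chart J i))
    (dual_field (in_chart g i) (in_chart K i)).

Lemma smooth_dual_triple i s : smooth_mx_on (chart_image i) (dual_triple i s).
Proof.
have [hI hJ hK q] := hIJK; have [hr gI gJ gK] := hg.
have [sg ug gT] := metric_chart hM hr i; have oU := chart_open hM (i:=i).
apply: smooth_triple; apply: (smooth_dual oU sg ug).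
- exact: (hermitian_chart hM i hI gI).
- exact: (hermitian_chart hM i hJ gJ).
- exact: (hermitian_chart hM i hK gK).
Qed.

Lemma sphere_coefE (a : sphere R) s :
  let x := val a 0 0 in let y := val a 0 1 in let z := val a 0 2%:R in
  sphere_coef a s = triple (2%:R^-1 * (1 - x * x)) (- 2%:R^-1 * (x * y)) (- 2%:R^-1 * (x * z)) s
    +i* triple 0 (- 2%:R^-1 * z) (2%:R^-1 * y) s.
Proof.
move=> x y z.
have E (p q : R) : p +i* q = p%:C + 'i * q%:C.
  by rewrite -complexiE [LHS]complexE.
have h : 2%:R^-1 = (2%:R^-1)%:C :> R[i] by rewrite fmorphV rmorph_nat.
rewrite /sphere_coef /twistor_coef /triple -/x -/y -/z E.
case: ifP => _; last case: ifP => _; rewrite h;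
  rewrite !(rmorphM, rmorphN, rmorphB, rmorph1, rmorph0) /=; ring.
Qed.

Lemma smooth_sphere_coef (V : set 'rV[R]_(n + 2)) b s : open V ->
  smooth_on V (fun v => complex.Re (sphere_coef (stereo_inv b (rsubmx v)) s)) /\
  smooth_on V (fun v => complex.Im (sphere_coef (stereo_inv b (rsubmx v)) s)).
Proof.
move=> oV.
have sv k : smooth_on V (fun v => val (stereo_inv b (rsubmx v)) 0 k).
  apply: (smooth_stereo_inv b k oV) => r q.
  apply: (smooth_eq oV _ (smooth_coord oV (rshift n q))) => v _.
  by rewrite mxE (ord1 r).
split; under eq_fun do rewrite sphere_coefE /=; rewrite /triple;
  (case: (s == 0); last case: (s == 1)).
- apply: smoothM => //; first exact: smooth_cst.
  apply: smoothD => //; first exact: smooth_cst.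
  by apply: smoothN => //; exact: smoothM.
- by apply: smoothM => //; [exact: smooth_cst|exact: smoothM].
- by apply: smoothM => //; [exact: smooth_cst|exact: smoothM].
- exact: smooth_cst.
- by apply: smoothM => //; exact: smooth_cst.
- by apply: smoothM => //; exact: smooth_cst.
Qed.

Lemma smooth_twistor_bivector k : smooth_cmx_on (chart_image k) (in_chart P k).
Proof.
case: k => i b; set V := [set v : 'rV[R]_(n + 2) | chart_image i (lsubmx v)].
have oU := chart_open hM (i:=i); have oV : open V := open_lsubmx oU.
have sub : chart_image (M := Z) (i, b) `<=` V by move=> v; exact: twistor_chart_image.
have PE v : V v -> in_chart P (i, b) v =
    block_mx (twistor_slice I J K g i (stereo_inv b (rsubmx v)) (lsubmx v)) 0 0 0.
  by move=> Vv; exact: (twistor_bivectorE hM hIJK hg b _ Vv).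
have sP s p q : smooth_on V (fun v => dual_triple i s (lsubmx v) p q).
  exact: (smooth_lsubmx oU (smooth_dual_triple s p q)).
(* The map [f] will be the real and then the imaginary part: both are additive and commute with
   multiplication by reals. *)
have part (f : R[i] -> R) : f 0 = 0 -> {morph f : x y / x + y} ->
    (forall c r, f (c * r%:C) = f c * r) ->
    (forall s, smooth_on V (fun v => f (sphere_coef (stereo_inv b (rsubmx v)) s))) ->
    smooth_mx_on (chart_image (M := Z) (i, b)) (fun v => map_mx f (in_chart P (i, b) v)).
  move=> f0 fD fM sf p q.
  suff S : smooth_on V (fun v => map_mx f (in_chart P (i, b) v) p q).
    by move=> l v Uv; apply: S; exact: sub.
  have S0 : smooth_on V (fun=> 0) by exact: smooth_cst.
  case: (split_ordP p) => {}p ->; case: (split_ordP q) => {}q ->.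
  - apply: (@smooth_eq _ _ V (fun v => \sum_s
        f (sphere_coef (stereo_inv b (rsubmx v)) s) * dual_triple i s (lsubmx v) p q)) => //.
      move=> v Vv; rewrite mxE PE// block_mxEul /twistor_slice /null_bivector summxE (big_morph f fD f0).
      have ZE (c : R[i]) (X : 'M[R]_n) : f ((c *: mxC X) p q) = f c * X p q.
        by rewrite !mxE fM.
      by apply: eq_bigr => s _; exact: esym (ZE _ _).
    by apply: smooth_sum => // s _; apply: smoothM.
  - by apply: (smooth_eq oV _ S0) => v Vv; rewrite mxE PE// block_mxEur mxE f0.
  - by apply: (smooth_eq oV _ S0) => v Vv; rewrite mxE PE// block_mxEdl mxE f0.
  - by apply: (smooth_eq oV _ S0) => v Vv; rewrite mxE PE// block_mxEdr mxE f0.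
split; apply: part => //.
- by move=> [x y] [x' y'].
- by move=> [x y] r /=; rewrite mulr0 subr0.
- by move=> s; case: (smooth_sphere_coef b s oV).
- by move=> [x y] [x' y'].
- by move=> [x y] r /=; rewrite mulr0 add0r.
- by move=> s; case: (smooth_sphere_coef b s oV).
Qed.

(** Each point of [Z] selects one slice and a point of [M], so vanishing on [Z] means vanishing on
    every slice, and [schouten_null] and [null_schouten] finish the two directions. *)
Lemma hkt_iff : HKT I J K g <-> forall k u, chart_image (M := Z) k u ->
  forall p q r, schouten (in_chart P k) (in_chart P k) u p q r = 0.
Proof.
have [hI hJ hK IJ] := hIJK; have [hr gI gJ gK] := hg.
have slice i b u : chart_image (M := Z) (i, b) u ->
    (forall p q r, schouten (in_chart P (i, b)) (in_chart P (i, b)) u p q r = 0) <->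
    (forall p q r, schouten (twistor_slice I J K g i (stereo_inv b (rsubmx u)))
      (twistor_slice I J K g i (stereo_inv b (rsubmx u))) (lsubmx u) p q r = 0).
  move=> Uu; apply: (schouten_block (chart_open hM (i:=i)) (twistor_chart_image Uu)) => w Uw.
  rewrite /in_chart /= row_mxKl row_mxKr.
  exact: (twistor_bivectorE hM hIJK hg b _ Uw).
have [JI1 IJ1] : (forall i v, chart_image i v -> in_chart J i v *m in_chart I i v = in_chart K i v) /\
    (forall i v, chart_image i v -> in_chart I i v *m in_chart J i v = - in_chart K i v).
  by split=> i v /(chart_imageP hM)[dv _]; have [] := IJ i _ dv.
split=> [hkt [i b] u Uu|H i u Uu].
  apply/(slice i b u Uu) => p q r; have Ul := twistor_chart_image Uu.
  have [sg ug gT] := metric_chart hM hr i.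
  apply: (schouten_null (chart_open hM (i:=i)) sg ug gT (hermitian_chart hM i hI gI)
    (hermitian_chart hM i hJ gJ) (hermitian_chart hM i hK gK) (JI1 i) (IJ1 i) Ul).
    exact: hkt i _ Ul.
  exact: (twistor_coef_null mulii (sphere_sum1 _)).
have [sg ug gT] := metric_chart hM hr i.
apply: (null_schouten (chart_open hM (i:=i)) sg ug gT (hermitian_chart hM i hI gI)
    (hermitian_chart hM i hJ gJ) (hermitian_chart hM i hK gK) Uu) => a b c abc p q r.
(* The integer unit vectors tested by [null_schouten] are realized as points of the sphere; some
   stereographic chart contains each of them, so the hypothesis on [Z] applies there. *)
have sa : \sum_k (\row_k [:: a%:~R; b%:~R; c%:~R]`_k : 'rV[R]_3) 0 k ^+ 2 == 1.
  by rewrite sum3 !mxE /= !expr2 -!intrM -!intrD abc.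
have [pt ptE] : exists pt : sphere R, val pt = \row_k [:: a%:~R; b%:~R; c%:~R]`_k.
  by exists (exist (fun v : 'rV[R]_3 => \sum_k v 0 k ^+ 2 == 1) _ sa).
have [e de] := sphere_dom_cover pt.
have Uu' : chart_image (M := Z) (i, e) (row_mx u (stereo e pt)).
  have [du cu] := chart_imageP hM Uu.
  by exists (param M i u, pt); rewrite /= ?cu.
have := (slice i e _ Uu').1 (H _ _ Uu') p q r.
rewrite row_mxKl row_mxKr (stereo_invK de).
rewrite /twistor_slice (_ : sphere_coef pt = twistor_coef 'i a%:~R b%:~R c%:~R)//.
by rewrite /sphere_coef ptE !mxE /= !rmorph_int.
Qed.

Lemma sphere_combination_sq a i (x : M) : dom M i x ->
  sphere_combination I J K a i x *m sphere_combination I J K a i x = - 1%:M.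
Proof.
move=> dx; have [[_ I2 _] [_ J2 _] [_ K2 _] q] := hIJK.
have [JI IJ] := q i x dx; have {}I2 := I2 i x dx; have {}J2 := J2 i x dx.
have {}K2 := K2 i x dx.
have KI : K i x *m I i x = - J i x by rewrite -JI -mulmxA I2 mulmxN mulmx1.
have JK : J i x *m K i x = - I i x by rewrite -JI mulmxA J2 mulNmx mul1mx.
have KJ : K i x *m J i x = I i x.
  by rewrite -[K i x]opprK -IJ mulNmx -mulmxA J2 mulmxN mulmx1 opprK.
have IK : I i x *m K i x = J i x.
  by rewrite -[K i x]opprK -IJ mulmxN mulmxA I2 mulNmx mul1mx opprK.
rewrite /sphere_combination !mulmxDl !mulmxDr -!scalemxAl -!scalemxAr.
rewrite I2 J2 K2 JI IJ KI JK KJ IK.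
transitivity ((- (val a 0 0 * val a 0 0 + val a 0 1 * val a 0 1
    + val a 0 2%:R * val a 0 2%:R)) *: 1%:M : 'M[R]_n).
  by apply/matrixP => r s; rewrite !mxE; ring.
by rewrite sphereE scaleN1r.
Qed.

(** The field and type conditions hold for every hyperhermitian metric, so the equivalence rests on
    the Schouten bracket. Type (2,0) holds because taking the (2,0) part is idempotent. *)
Lemma HKT_complex_poisson : HKT I J K g <->
  complex_poisson (twistor_structure I J K) P.
Proof.
split=> [/hkt_iff H|[_ _ H]]; last exact/hkt_iff.
have [hI hJ hK IJ] := hIJK; have [hr gI gJ gK] := hg.
split; [split| |exact: H].
- move=> [i b] [x a] [/= dx _]; rewrite (twistor_pointE b a dx) tr_block_mx !trmx0.
  rewrite twistor_sliceT; last by exists x.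
  by rewrite opp_block_mx !oppr0.
- exact: twistor_bivector_transition.
- exact: smooth_twistor_bivector.
move=> [i b] [x a] [/= dx _]; rewrite /P /twistor_bivector pushforward_section//.
rewrite /mxC map_block_mx -!/(mxC _) !mxC0 /twistor_structure !bivector20_block.
by rewrite bivector20_idem// sphere_combination_sq.
Qed.

End Field.

Theorem theorem3p3 (R : realType) (n : nat) (M : atlas R n)
    (I J K g : components M R)
    (hM : smooth_manifold M)
    (hIJK : hypercomplex I J K)
    (hg : hyperhermitian I J K g) :
  HKT I J K g <->
  complex_poisson (twistor_structure I J K) (twistor_bivector I J K g).
Proof. exact: HKT_complex_poisson. Qed.
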